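(* Let $\phi:\mathbb Z\to\mathbb C$ be an absolutely summable function whose Fourier transform $\hat\phi$ satisfies $|\hat\phi(\theta)|\le1$ for all $\theta\in[-\pi,\pi]$. Assume that, on $(-\pi,\pi]$, $|\hat\phi(\xi)|<1$ except at a finite number of points $\xi_q$, $q\in\{1,\dots,Q\}$, where $|\hat\phi(\xi_q)|=1$. Assume further that there are an integer $Q_1\le Q$, a positive even integer $m$ and constants $\alpha_q$, $\beta_q=b_q+ib'_q$, $q=1,\dots,Q_1$, with $\alpha_q,b_q,b_q'\in\mathbb R$ and $b_q=\operatorname{Re}(\beta_q)>0$, such that for all $q\in\{1,\dots,Q_1\}$, $$\hat\phi(\xi_q+\xi)=\hat\phi(\xi_q)\exp\left(i\alpha_q\xi-\beta_q\xi^m(1+o(1))\right)\qquad\text{as }\xi\to0,$$ and that there are $\mu\in(0,m)$ and constants $c_q>0$ such that for all $q\in\{Q_1+1,\dots,Q\}$, $$|\hat\phi(\xi_q+\xi)|\le\exp\left(-c_q|\xi|^\mu\right)\qquad\text{as }\xi\to0$$ (i.e. for all $\xi$ sufficiently close to $0$). Then, as $n\to\infty$, $$\phi^{(n)}(x)=\sum_{q=1}^{Q_1}(b_qn)^{-1/m}e^{-ix\xi_q}\hat\phi(\xi_q)^nH_{m,b'_q/b_q}\left((x-\alpha_qn)(b_qn)^{-1/m}\right)+o(n^{-1/m}),$$ where the error term is uniform in $x\in\mathbb Z$.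
   Context: For an absolutely summable $\phi:\mathbb Z\to\mathbb C$, $\hat\phi(\theta)=\sum_{x}\phi(x)e^{ix\theta}$, and convolution powers are $\phi^{(1)}=\phi$, $\phi^{(n)}(x)=\sum_{y}\phi^{(n-1)}(y)\phi(x-y)$ for $n\ge 2$. For a positive even integer $m$ and $b\in\mathbb R$, $H_{m,b}:\mathbb R\to\mathbb C$ is the Schwartz function whose Fourier transform is $\hat H_{m,b}(\xi)=e^{-(1+ib)\xi^m}$, that is, $H_{m,b}(x)=\frac1{2\pi}\int_{-\infty}^{\infty}e^{-ix\xi}e^{-(1+ib)\xi^m}\,d\xi$. *)

(* Defs.v *)
From Stdlib Require Import Reals ZArith Arith.
From Coquelicot Require Import Coquelicot.

Open Scope R_scope.

Definition Cexp (z : C) : C :=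
  (exp (Re z) * cos (Im z), exp (Re z) * sin (Im z)).

(* Coquelicot's total operator Series is real-valued, hence the components. *)
Definition CSeries (a : nat -> C) : C :=
  (Series (fun n => Re (a n)), Series (fun n => Im (a n))).

(* A sum over Z is split into the indices 0, 1, 2, ... and -1, -2, ...; all
   sums below are absolutely convergent, so the splitting is immaterial. *)
Definition ZSeries (f : Z -> C) : C :=
  Cplus (CSeries (fun n => f (Z.of_nat n)))
        (CSeries (fun n => f (- Z.of_nat (S n))%Z)).

Definition abs_summable (f : Z -> C) : Prop :=
  ex_series (fun n => Cmod (f (Z.of_nat n))) /\
  ex_series (fun n => Cmod (f (- Z.of_nat (S n))%Z)).

Definition fourier (phi : Z -> C) (theta : R) : C :=
  ZSeries (fun x => phi x * Cexp (Ci * IZR x * theta))%C.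

Definition conv (f g : Z -> C) (x : Z) : C :=
  ZSeries (fun y => f y * g (x - y)%Z)%C.

(* The exponent 0, not used in the mathematics, gives the unit of conv. *)
Fixpoint conv_pow (phi : Z -> C) (n : nat) : Z -> C :=
  match n with
  | O => fun x => if Z.eqb x 0 then RtoC 1 else RtoC 0
  | S O => phi
  | S k => conv (conv_pow phi k) phi
  end.

Definition H (m : nat) (b : R) (x : R) : C :=
  (RtoC (/ (2 * PI)) *
   RInt_gen (V := C_R_CompleteNormedModule)
     (fun xi : R =>
        Cexp (- (Ci * x * xi)) * Cexp (- ((1 + Ci * b) * RtoC (xi ^ m))))
     (Rbar_locally m_infty) (Rbar_locally p_infty))%C.

(* Main.v *)
Require Import Defs.
From Stdlib Require Import Reals ZArith Arith Lra Lia.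
From Coquelicot Require Import Coquelicot.

Open Scope R_scope.

(** Fourier inversion writes the convolution power as an integral over one
    period,
      [conv_pow phi n x = 1 / (2 pi) * int exp (- i x t) * f t ^ n dt],
    with [f = fourier phi] ([conv_pow_inv_fourier]). For large [n] the power
    [f ^ n] is concentrated at the points [xi q] where [|f| = 1], on the scale
    [1 / N], [N = n ^ (1 / m)].

    At a point with [q <= Q1] the power is close to its [model]
      [f (xi q) ^ n * exp (n * (i alpha s - beta s ^ m))], [s = t - xi q],
    and the error has the form [eps / (1 + (N s) ^ 2)], with [eps] as small as
    desired when [s] stays in a small window ([local_approx]). At the other
    points the decay with exponent [mu < m] dominates that of
    [exp (- (s / eps) ^ m)] in a small window, so [|f ^ n|] is at most
    [3 / (1 + (N s / eps) ^ 2)] ([local_fast_decay]). Away from all the points,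
    [|f| <= exp (- kappa)] by compactness ([uniform_gap]), and there the models
    are exponentially small as well. Hence [f ^ n] minus the sum of the
    translated models is bounded on the whole period by such profiles plus
    an exponentially small constant ([error_majorant]). The integral of a
    profile is explicit, thanks to the arctangent, and is at most
    [4 pi eps / N]. The factor [exp (- i x t)] has modulus [1], so that
    all of this is uniform in [x].

    It remains to integrate the models over the period. The substitution
    [u = (b n) ^ (1 / m) (t - xi q)] gives the integral that defines [H],
    restricted to an interval whose ends move to infinity like [N]
    ([inv_fourier_model]); as the integrand of [H] is [O (u ^ -2)], the
    truncation costs [O (1 / N)] for [H], hence [O (1 / N ^ 2)] after the
    prefactor ([H_approx]). Quadratic decay is the only property of
    [exp (- u ^ m)] used in the integrations. *)

(** * Complex-valued functions of a real variable *)

Lemma norm_C_R (z : C) : norm (V := C_R_NormedModule) z = Cmod z.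
Proof.
  change (sqrt (Rabs (Re z) ^ 2 + Rabs (Im z) ^ 2) = Cmod z). unfold Cmod.
  now rewrite <- !Rsqr_pow2, <- !Rsqr_abs, !Rsqr_pow2.
Qed.

Lemma C_eq (z w : C) : Re z = Re w -> Im z = Im w -> z = w.
Proof. destruct z, w; simpl; congruence. Qed.

Lemma Re_plus (z w : C) : Re (z + w)%C = Re z + Re w.
Proof. reflexivity. Qed.

Lemma Im_plus (z w : C) : Im (z + w)%C = Im z + Im w.
Proof. reflexivity. Qed.

Lemma im_le_Cmod (z : C) : Rabs (Im z) <= Cmod z.
Proof. apply Rle_trans with (2 := Rmax_Cmod z). apply Rmax_r. Qed.

Lemma Cmod_sym (z w : C) : Cmod (z - w) = Cmod (w - z).
Proof. rewrite <- Cmod_opp. f_equal. ring. Qed.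

Lemma Cmod_triangle_minus (z w : C) : Cmod (z - w) <= Cmod z + Cmod w.
Proof. rewrite <- (Cmod_opp w). apply Cmod_triangle. Qed.

Lemma Cmod_triangle3 (z u w : C) : Cmod (z - w) <= Cmod (z - u) + Cmod (u - w).
Proof. replace (z - w)%C with ((z - u) + (u - w))%C by ring. apply Cmod_triangle. Qed.

Lemma continuous_C_components (f : R -> C) (x : R) :
  continuous (fun t => Re (f t)) x -> continuous (fun t => Im (f t)) x ->
  continuous f x.
Proof.
  intros H1 H2. apply filterlim_locally. intros e.
  generalize (proj1 (filterlim_locally _ _) H1 e)
    (proj1 (filterlim_locally _ _) H2 e); intros K1 K2.
  generalize (filter_and _ _ K1 K2). apply filter_imp.
  intros y [A B]. split; assumption.
Qed.

Lemma continuous_Re (f : R -> C) (x : R) :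
  continuous f x -> continuous (fun t => Re (f t)) x.
Proof.
  intros H1. apply filterlim_locally. intros e.
  generalize (proj1 (filterlim_locally _ _) H1 e).
  apply filter_imp. intros y [A B]. exact A.
Qed.

Lemma continuous_Im (f : R -> C) (x : R) :
  continuous f x -> continuous (fun t => Im (f t)) x.
Proof.
  intros H1. apply filterlim_locally. intros e.
  generalize (proj1 (filterlim_locally _ _) H1 e).
  apply filter_imp. intros y [A B]. exact B.
Qed.

Lemma continuous_Cplus (f g : R -> C) (x : R) :
  continuous f x -> continuous g x -> continuous (fun t => (f t + g t)%C) x.
Proof. intros. apply (continuous_plus (V := C_R_NormedModule)); assumption. Qed.

Lemma continuous_Cminus (f g : R -> C) (x : R) :
  continuous f x -> continuous g x -> continuous (fun t => (f t - g t)%C) x.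
Proof. intros. apply (continuous_minus (V := C_R_NormedModule)); assumption. Qed.

Lemma continuous_Cmult (f g : R -> C) (x : R) :
  continuous f x -> continuous g x -> continuous (fun t => (f t * g t)%C) x.
Proof.
  intros Hf Hg. apply continuous_C_components; simpl.
  - apply (continuous_minus (V := R_NormedModule)).
    + apply (continuous_mult (K := R_AbsRing)); apply continuous_Re; assumption.
    + apply (continuous_mult (K := R_AbsRing)); apply continuous_Im; assumption.
  - apply (continuous_plus (V := R_NormedModule)).
    + apply (continuous_mult (K := R_AbsRing));
        [apply continuous_Re | apply continuous_Im]; assumption.
    + apply (continuous_mult (K := R_AbsRing));
        [apply continuous_Im | apply continuous_Re]; assumption.
Qed.

Lemma continuous_Cpow (f : R -> C) (n : nat) (x : R) :
  continuous f x -> continuous (fun t => (f t ^ n)%C) x.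
Proof.
  intros Hf. induction n as [|n IH]; simpl.
  - apply continuous_const.
  - apply continuous_Cmult; assumption.
Qed.

Lemma continuous_Cexp_comp (f : R -> C) (x : R) :
  continuous f x -> continuous (fun t => Cexp (f t)) x.
Proof.
  intros Hf. apply continuous_C_components; unfold Cexp; simpl;
  apply (continuous_mult (K := R_AbsRing)).
  - apply (continuous_comp (fun t => Re (f t)) exp).
    now apply continuous_Re. apply continuous_exp.
  - apply (continuous_comp (fun t => Im (f t)) cos).
    now apply continuous_Im. apply continuous_cos.
  - apply (continuous_comp (fun t => Re (f t)) exp).
    now apply continuous_Re. apply continuous_exp.
  - apply (continuous_comp (fun t => Im (f t)) sin).
    now apply continuous_Im. apply continuous_sin.
Qed.

Lemma continuous_RtoC_comp (f : R -> R) (x : R) :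
  continuous f x -> continuous (fun t => RtoC (f t)) x.
Proof.
  intros Hf. apply continuous_C_components; simpl.
  exact Hf. apply continuous_const.
Qed.

Lemma continuous_Cmod_comp (f : R -> C) (x : R) :
  continuous f x -> continuous (fun t => Cmod (f t)) x.
Proof.
  intros Hf. apply (filterlim_ext (fun t => norm (V := C_R_NormedModule) (f t))).
  intros t; apply norm_C_R.
  rewrite <- norm_C_R.
  apply (continuous_comp (V := C_R_NormedModule) f (fun z => norm z)); [exact Hf|].
  apply (filterlim_norm (V := C_R_NormedModule)).
Qed.

Lemma continuous_C_eps (f : R -> C) (x : R) :
  (forall eps, 0 < eps -> locally x (fun y => Cmod (f y - f x) < eps)) ->
  continuous f x.
Proof.
  intros Hf. apply filterlim_locally. intros e.
  generalize (Hf e (cond_pos e)). apply filter_imp.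
  intros y Hy. apply C_NormedModule_mixin_compat1. exact Hy.
Qed.

(** ** The exponential *)

Lemma Cexp_plus (z w : C) : Cexp (z + w) = (Cexp z * Cexp w)%C.
Proof.
  unfold Cexp. rewrite Re_plus, Im_plus, exp_plus, cos_plus, sin_plus.
  apply C_eq; simpl; ring.
Qed.

Lemma Cexp_0 : Cexp 0 = 1%C.
Proof. unfold Cexp; simpl. rewrite exp_0, cos_0, sin_0. apply C_eq; simpl; ring. Qed.

Lemma Cexp_pow (z : C) (n : nat) : (Cexp z ^ n)%C = Cexp (RtoC (INR n) * z).
Proof.
  induction n as [|n IH].
  - simpl. replace (0 * z)%C with (RtoC 0) by ring. now rewrite Cexp_0.
  - rewrite Cpow_S, IH, <- Cexp_plus, S_INR, RtoC_plus. f_equal. ring.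
Qed.

Lemma Cmod_Cexp (z : C) : Cmod (Cexp z) = exp (Re z).
Proof.
  unfold Cexp, Cmod; simpl.
  replace (_ + _) with (exp (Re z) * exp (Re z)).
  - apply sqrt_square. left; apply exp_pos.
  - generalize (sin2_cos2 (Im z)). unfold Rsqr. intros E.
    transitivity (exp (Re z) * exp (Re z) * (sin (Im z) * sin (Im z) + cos (Im z) * cos (Im z))).
    rewrite E; ring. ring.
Qed.

Lemma Cmod_Cexp_imag (z : C) : Re z = 0 -> Cmod (Cexp z) = 1.
Proof. intros E. now rewrite Cmod_Cexp, E, exp_0. Qed.

(** ** Integrals *)

Definition CI (f : R -> C) (a b : R) : C :=
  RInt (V := C_R_CompleteNormedModule) f a b.

Definition Ccontinuous (f : R -> C) := forall t : R, continuous f t.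

Lemma is_CI (f : R -> C) (a b : R) : Ccontinuous f ->
  is_RInt (V := C_R_NormedModule) f a b (CI f a b).
Proof.
  intros Hf. apply (RInt_correct (V := C_R_CompleteNormedModule)).
  apply ex_RInt_continuous. intros; apply Hf.
Qed.

Lemma CI_unique (f : R -> C) (a b : R) (l : C) :
  is_RInt (V := C_R_NormedModule) f a b l -> CI f a b = l.
Proof. exact (is_RInt_unique (V := C_R_CompleteNormedModule) f a b l). Qed.

Lemma CI_ext (f g : R -> C) (a b : R) : (forall t, f t = g t) -> CI f a b = CI g a b.
Proof. intros E. apply (RInt_ext (V := C_R_CompleteNormedModule)). intros; apply E. Qed.

Lemma CI_plus (f g : R -> C) (a b : R) : Ccontinuous f -> Ccontinuous g ->
  CI (fun t => f t + g t)%C a b = (CI f a b + CI g a b)%C.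
Proof.
  intros Hf Hg. apply CI_unique.
  apply (is_RInt_plus (V := C_R_NormedModule)); apply is_CI; assumption.
Qed.

Lemma CI_minus (f g : R -> C) (a b : R) : Ccontinuous f -> Ccontinuous g ->
  CI (fun t => f t - g t)%C a b = (CI f a b - CI g a b)%C.
Proof.
  intros Hf Hg. apply CI_unique.
  apply (is_RInt_minus (V := C_R_NormedModule)); apply is_CI; assumption.
Qed.

Lemma CI_Chasles (f : R -> C) (a b c : R) : Ccontinuous f ->
  CI f a c = (CI f a b + CI f b c)%C.
Proof.
  intros Hf. apply CI_unique.
  apply (is_RInt_Chasles (V := C_R_NormedModule)) with b; apply is_CI; assumption.
Qed.

Lemma CI_swap (f : R -> C) (a b : R) : Ccontinuous f -> CI f a b = (- CI f b a)%C.
Proof.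
  intros Hf. apply CI_unique.
  apply (is_RInt_swap (V := C_R_NormedModule)); apply is_CI; assumption.
Qed.

Lemma CI_scal (c : C) (f : R -> C) (a b : R) : Ccontinuous f ->
  CI (fun t => c * f t)%C a b = (c * CI f a b)%C.
Proof.
  intros Hf. apply CI_unique.
  pose proof (is_CI f a b Hf) as If.
  pose proof (is_RInt_fct_extend_fst _ _ _ _ If) as I1.
  pose proof (is_RInt_fct_extend_snd _ _ _ _ If) as I2.
  apply (is_RInt_fct_extend_pair (U := R_NormedModule) (V := R_NormedModule)).
  - apply (is_RInt_minus (V := R_NormedModule));
    apply (is_RInt_scal (V := R_NormedModule)); assumption.
  - apply (is_RInt_plus (V := R_NormedModule));
    apply (is_RInt_scal (V := R_NormedModule)); assumption.
Qed.

Lemma CI_affine (f g : R -> C) (u v a b : R) : Ccontinuous f ->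
  (forall t, g t = (RtoC u * f (u * t + v)%R)%C) ->
  CI g a b = CI f (u * a + v) (u * b + v).
Proof.
  intros Hf E. apply CI_unique.
  apply (is_RInt_ext (V := C_R_NormedModule) (fun t => scal u (f (u * t + v)))).
  - intros t _. rewrite E.
    change (scal u (f (u * t + v))) with (u * fst (f (u * t + v)), u * snd (f (u * t + v))).
    apply C_eq; simpl; ring.
  - apply (is_RInt_comp_lin (V := C_R_NormedModule)). now apply is_CI.
Qed.

Lemma Cmod_CI_le (f : R -> C) (g : R -> R) (a b l : R) : a <= b -> Ccontinuous f ->
  (forall t, a <= t <= b -> Cmod (f t) <= g t) ->
  is_RInt g a b l -> Cmod (CI f a b) <= l.
Proof.
  intros Hab Hf Hg Il. rewrite <- norm_C_R.
  apply (norm_RInt_le (V := C_R_NormedModule) f g a b); auto.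
  - intros t Ht. rewrite norm_C_R. now apply Hg.
  - now apply is_CI.
Qed.

Definition Csum (E : nat -> C) (n : nat) : C :=
  sum_n_m (G := C_AbelianMonoid) E 1 n.

Lemma sum_C_Sm (E : nat -> C) (n : nat) :
  Csum E (S n) =
  (Csum E n + E (S n))%C.
Proof. apply (sum_n_Sm (G := C_AbelianMonoid)). lia. Qed.

Lemma sum_C_0 (E : nat -> C) : Csum E 0 = RtoC 0.
Proof. apply (sum_n_m_zero (G := C_AbelianMonoid)). lia. Qed.

Lemma continuous_Csum (E : nat -> R -> C) (n : nat) :
  (forall q, (1 <= q <= n)%nat -> Ccontinuous (E q)) ->
  Ccontinuous (fun t => Csum (fun q => E q t) n).
Proof.
  induction n as [|n IH]; intros HE t.
  - apply (continuous_ext (fun _ => RtoC 0)).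
    intros; now rewrite sum_C_0. apply continuous_const.
  - apply (continuous_ext (fun t =>
      Csum (fun q => E q t) n + E (S n) t)%C).
    intros; now rewrite sum_C_Sm.
    apply continuous_Cplus. apply IH; intros; apply HE; lia. apply HE; lia.
Qed.

Lemma Cmod_sum_diff_le (E F : nat -> C) (n : nat) (r : R) :
  (forall q, (1 <= q <= n)%nat -> Cmod (E q - F q) <= r) ->
  Cmod (Csum E n - Csum F n)
  <= INR n * r.
Proof.
  induction n as [|n IH]; intros HE.
  - rewrite !sum_C_0. replace (0 - 0)%C with (RtoC 0) by ring. rewrite Cmod_0. simpl; lra.
  - rewrite !sum_C_Sm, S_INR.
    replace (_ - _)%C with ((Csum E n -
      Csum F n) + (E (S n) - F (S n)))%C by ring.
    eapply Rle_trans; [apply Cmod_triangle|].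
    assert (Cmod (E (S n) - F (S n)) <= r) by (apply HE; lia).
    assert (K := IH ltac:(intros; apply HE; lia)). lra.
Qed.

Lemma Cmod_sum_le (E : nat -> C) (n : nat) (r : R) :
  (forall q, (1 <= q <= n)%nat -> Cmod (E q) <= r) ->
  Cmod (Csum E n) <= INR n * r.
Proof.
  induction n as [|n IH]; intros HE.
  - rewrite !sum_C_0, Cmod_0. simpl; lra.
  - rewrite !sum_C_Sm, S_INR.
    eapply Rle_trans; [apply Cmod_triangle|].
    assert (Cmod (E (S n)) <= r) by (apply HE; lia).
    assert (K := IH ltac:(intros; apply HE; lia)). lra.
Qed.

Lemma Cmod_sum_minus_term_le (E : nat -> C) (n q0 : nat) (r : R) : 0 <= r ->
  (1 <= q0 <= n)%nat ->
  (forall q, (1 <= q <= n)%nat -> q <> q0 -> Cmod (E q) <= r) ->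
  Cmod (Csum E n - E q0) <= INR n * r.
Proof.
  intros Hr. induction n as [|n IH]; intros Hq HE. lia.
  rewrite !sum_C_Sm, S_INR.
  destruct (Nat.eq_dec q0 (S n)) as [->|Hne].
  - replace (_ - _)%C with (Csum E n) by ring.
    assert (K := Cmod_sum_le E n r ltac:(intros; apply HE; lia)). lra.
  - replace (_ - _)%C with ((Csum E n - E q0) + E (S n))%C by ring.
    eapply Rle_trans; [apply Cmod_triangle|].
    assert (Cmod (E (S n)) <= r) by (apply HE; lia).
    assert (H1 : Cmod (Csum E n - E q0) <= INR n * r).
    apply IH. lia. intros; apply HE; lia. lra.
Qed.

(** * Series of complex numbers *)

Definition Cis_series (a : nat -> C) (l : C) : Prop :=
  is_series (K := C_AbsRing) (V := C_NormedModule) a l.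

Lemma CSeries_unique (a : nat -> C) (l : C) : Cis_series a l -> CSeries a = l.
Proof.
  intros Ha. unfold CSeries.
  assert (E : forall n, sum_n (G := C_AbelianMonoid) a n =
     (sum_n (fun k => Re (a k)) n, sum_n (fun k => Im (a k)) n)).
  { intros n. induction n as [|n IH].
    - rewrite !sum_O. now destruct (a 0%nat).
    - rewrite !sum_Sn, IH. now destruct (a (S n)). }
  assert (K : forall P : C -> Prop, locally l P -> eventually (fun n =>
    P (sum_n (fun k => Re (a k)) n, sum_n (fun k => Im (a k)) n))).
  { intros P HP.
    assert (X : eventually (fun n => P (sum_n (G := C_AbelianMonoid) a n)))
      by exact (Ha P HP).
    revert X. apply filter_imp. intros n. now rewrite E. }
  apply C_eq; simpl; apply is_series_unique; apply filterlim_locally; intros e.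
  - apply (K (fun z => ball (Re l) e (Re z))). exists e. now intros z [A B].
  - apply (K (fun z => ball (Im l) e (Im z))). exists e. now intros z [A B].
Qed.

Lemma CSeries_correct (a : nat -> C) :
  ex_series (fun k => Cmod (a k)) -> Cis_series a (CSeries a).
Proof.
  intros Ha.
  destruct (ex_series_le (V := C_CompleteNormedModule) a (fun k => Cmod (a k))) as [l Hl].
  - intros n. apply Rle_refl.
  - exact Ha.
  - rewrite (CSeries_unique a l Hl). exact Hl.
Qed.

Lemma CSeries_ext (a b : nat -> C) : (forall k, a k = b k) -> CSeries a = CSeries b.
Proof.
  intros E. unfold CSeries. f_equal; apply Series_ext; intros n; now rewrite E.
Qed.

Lemma Cis_series_bound (a : nat -> C) (l : C) (M : nat -> R) :
  Cis_series a l -> (forall k, Cmod (a k) <= M k) -> ex_series M ->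
  Cmod l <= Series M.
Proof.
  intros Ha HM EM.
  apply (filterlim_le (F := eventually)
    (fun n => norm (sum_n (G := C_AbelianMonoid) a n : C_NormedModule)) (sum_n M)
    (Cmod l) (Series M)).
  - apply filter_forall. intros n.
    eapply Rle_trans. apply (norm_sum_n_m (V := C_NormedModule)).
    apply sum_n_m_le. exact HM.
  - apply (filterlim_comp _ _ _ _ (norm (V := C_NormedModule)) _ _ _ Ha).
    apply (filterlim_norm (V := C_NormedModule)).
  - exact (Series_correct M EM).
Qed.

Lemma Series_tail_small (M : nat -> R) (eps : R) : 0 < eps -> ex_series M ->
  exists n0, forall n, (n0 <= n)%nat -> Series (fun k => M (S n + k)%nat) < eps.
Proof.
  intros He EM. pose proof (Series_correct M EM) as SM.
  destruct (proj1 (filterlim_locally _ _) SM (mkposreal eps He)) as [n0 Hn0].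
  exists n0. intros n Hn. specialize (Hn0 n Hn).
  replace (Series (fun k => M (S n + k)%nat)) with (Series M - sum_n M n).
  - change (Rabs (sum_n M n - Series M) < eps) in Hn0.
    apply Rabs_def2 in Hn0. lra.
  - symmetry. apply is_series_unique.
    apply (is_series_incr_n M (S n)). lia.
    change (is_series M ((Series M - sum_n M n) + sum_n M n)).
    replace (Series M - sum_n M n + sum_n M n) with (Series M) by ring. exact SM.
Qed.

(** The bound depends on the majorant only, so it is uniform in any parameter
    on which [a] depends: this is the Weierstrass M-test. *)
Lemma CSeries_tail (a : nat -> C) (M : nat -> R) (n : nat) :
  (forall k, Cmod (a k) <= M k) -> ex_series M ->
  Cmod (CSeries a - sum_n (G := C_AbelianMonoid) a n) <= Series (fun k => M (S n + k)%nat).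
Proof.
  intros HM EM.
  apply (Cis_series_bound (fun k => a (S n + k)%nat)).
  - apply (is_series_incr_n (V := C_NormedModule) a (S n)). lia.
    set (s := sum_n (G := C_AbelianMonoid) a n : C).
    change (Cis_series a ((CSeries a - s) + s)).
    replace ((CSeries a - s) + s)%C with (CSeries a) by ring.
    apply CSeries_correct.
    apply (ex_series_le (V := R_CompleteNormedModule) _ M); [|exact EM].
    intros k. unfold norm; simpl. unfold abs; simpl. rewrite Rabs_pos_eq; auto.
    apply Cmod_ge_0.
  - intros k; apply HM.
  - now apply ex_series_incr_n.
Qed.

Section UniformSeries.

Context (f : nat -> R -> C) (M : nat -> R)
  (Hf : forall k, Ccontinuous (f k))
  (HM : forall k t, Cmod (f k t) <= M k)
  (EM : ex_series M).

Lemma continuous_partial_sum (n : nat) :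
  Ccontinuous (fun t => sum_n (G := C_AbelianMonoid) (fun k => f k t) n).
Proof.
  induction n as [|n IH]; intros t.
  - apply (continuous_ext (f 0%nat)). intros; now rewrite sum_O. apply Hf.
  - apply (continuous_ext (fun t =>
      (sum_n (G := C_AbelianMonoid) (fun k => f k t) n : C) + f (S n) t)%C).
    intros; now rewrite sum_Sn. apply continuous_Cplus. apply IH. apply Hf.
Qed.

Lemma continuous_CSeries : Ccontinuous (fun t => CSeries (fun k => f k t)).
Proof.
  intros t. apply continuous_C_eps. intros eps He.
  destruct (Series_tail_small M (eps / 3)) as [n Hn]; [lra | exact EM |].
  specialize (Hn n (Nat.le_refl n)).
  set (s := fun t => sum_n (G := C_AbelianMonoid) (fun k => f k t) n : C).
  assert (T : forall u, Cmod (CSeries (fun k => f k u) - s u) < eps / 3).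
  { intros u. eapply Rle_lt_trans; [|exact Hn]. apply CSeries_tail; auto. }
  assert (L : locally t (fun u => Cmod (s u - s t) < eps / 3)).
  { assert (K : continuous (fun u => Cmod (s u - s t)) t).
    { apply continuous_Cmod_comp. apply continuous_Cminus.
      apply (continuous_partial_sum n t). apply continuous_const. }
    generalize (proj1 (filterlim_locally _ _) K (mkposreal (eps / 3) ltac:(lra))).
    apply filter_imp. intros u Hu.
    change (Rabs (Cmod (s u - s t) - Cmod (s t - s t)) < eps / 3) in Hu.
    replace (s t - s t)%C with (RtoC 0) in Hu by ring. rewrite Cmod_0 in Hu.
    apply Rabs_def2 in Hu. lra. }
  revert L. apply filter_imp. intros u Hu.
  replace (CSeries (fun k => f k u) - CSeries (fun k => f k t))%C with
    ((CSeries (fun k => f k u) - s u) + ((s u - s t) - (CSeries (fun k => f k t) - s t)))%C by ring.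
  eapply Rle_lt_trans; [apply Cmod_triangle|].
  pose proof (Cmod_triangle_minus (s u - s t) (CSeries (fun k => f k t) - s t)).
  pose proof (T u); pose proof (T t). lra.
Qed.

(** The partial sums converge uniformly, and the integral over a bounded
    interval is continuous for uniform convergence. *)
Lemma CSeries_CI (a b : R) :
  CI (fun t => CSeries (fun k => f k t)) a b = CSeries (fun k => CI (f k) a b).
Proof.
  set (s := fun n t => sum_n (G := C_AbelianMonoid) (fun k => f k t) n : C).
  destruct (filterlim_RInt (V := C_R_CompleteNormedModule) s a b eventually _
    (fun t => CSeries (fun k => f k t)) (fun n => CI (s n) a b)) as [l [L I]].
  - intros n. apply is_CI. apply continuous_partial_sum.
  - apply filterlim_locally. intros e.
    destruct (Series_tail_small M e (cond_pos e) EM) as [n0 Hn0].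
    exists n0. intros n Hn t. apply C_NormedModule_mixin_compat1.
    change (Cmod (s n t - CSeries (fun k => f k t)) < e).
    rewrite Cmod_sym. eapply Rle_lt_trans; [|exact (Hn0 n Hn)].
    apply CSeries_tail; auto.
  - rewrite (CI_unique _ _ _ _ I). symmetry. apply CSeries_unique.
    refine (filterlim_ext _ _ _ L). intros n. unfold s. clear L.
    change (CI (fun t => sum_n (G := C_AbelianMonoid) (fun k => f k t) n) a b =
      sum_n (G := C_AbelianMonoid) (fun k => CI (f k) a b) n).
    induction n as [|n IH].
    + rewrite sum_O. apply CI_ext. intros; now rewrite sum_O.
    + rewrite sum_Sn, <- IH.
      rewrite (CI_ext _ (fun t =>
        (sum_n (G := C_AbelianMonoid) (fun k => f k t) n : C) + f (S n) t)%C).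
      apply CI_plus. apply continuous_partial_sum. apply Hf.
      intros; now rewrite sum_Sn.
Qed.

End UniformSeries.

(** * Series over the integers *)

(** Pairing the two half-series reduces sums over the integers to [CSeries]. *)
Definition zpair (f : Z -> C) (k : nat) : C :=
  (f (Z.of_nat k) + f (- Z.of_nat (S k))%Z)%C.

Lemma ZSeries_ext (f g : Z -> C) : (forall y, f y = g y) -> ZSeries f = ZSeries g.
Proof. intros E. unfold ZSeries. f_equal; apply CSeries_ext; intros; apply E. Qed.

Lemma abs_summable_le (f : Z -> C) (g : Z -> C) (B : R) :
  (forall y, Cmod (f y) <= B * Cmod (g y)) -> abs_summable g -> abs_summable f.
Proof.
  intros HB [G1 G2]. split.
  - apply (ex_series_le (V := R_CompleteNormedModule) _
      (fun k => B * Cmod (g (Z.of_nat k)))).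
    + intros k. unfold norm; simpl. unfold abs; simpl.
      rewrite Rabs_pos_eq by apply Cmod_ge_0. apply HB.
    + now apply (ex_series_scal (V:=R_NormedModule) B).
  - apply (ex_series_le (V := R_CompleteNormedModule) _
      (fun k => B * Cmod (g (- Z.of_nat (S k))%Z))).
    + intros k. unfold norm; simpl. unfold abs; simpl.
      rewrite Rabs_pos_eq by apply Cmod_ge_0. apply HB.
    + now apply (ex_series_scal (V:=R_NormedModule) B).
Qed.

Lemma ZSeries_zpair (f : Z -> C) : abs_summable f -> Cis_series (zpair f) (ZSeries f).
Proof.
  intros [F1 F2]. unfold zpair, ZSeries.
  apply (is_series_plus (V := C_NormedModule)).
  now apply CSeries_correct.
  apply (CSeries_correct (fun n => f (- Z.of_nat (S n))%Z) F2).
Qed.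

(** The reflection and the unit shift of the integers both amount, up to
    an exchange of the two halves, to moving one term from one half-series to
    the other. *)
Lemma half_series_move (p n p' n' : nat -> C) :
  (forall k, p' k = p (S k)) -> n' 0%nat = p 0%nat -> (forall k, n' (S k) = n k) ->
  ex_series (fun k => Cmod (p k)) -> ex_series (fun k => Cmod (n k)) ->
  ex_series (fun k => Cmod (p' k)) /\ ex_series (fun k => Cmod (n' k)) /\
  (CSeries p' + CSeries n' = CSeries p + CSeries n)%C.
Proof.
  intros Hp Hn0 Hn Ep En.
  assert (Ep' : ex_series (fun k => Cmod (p' k))).
  { apply (ex_series_ext (fun k => Cmod (p (S k)))). intros; now rewrite Hp.
    now apply (ex_series_incr_1 (fun k => Cmod (p k))). }
  assert (En' : ex_series (fun k => Cmod (n' k))).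
  { apply ex_series_incr_1. apply (ex_series_ext (fun k => Cmod (n k))).
    intros; now rewrite Hn. exact En. }
  split; [exact Ep' | split; [exact En' |]].
  rewrite (CSeries_unique p' (CSeries p - p 0%nat)%C).
  rewrite (CSeries_unique n' (CSeries n + p 0%nat)%C). 1: ring.
  - apply (is_series_decr_1 (V := C_NormedModule)).
    apply (is_series_ext (V := C_NormedModule) n). intros; now rewrite Hn.
    rewrite Hn0. unfold plus, opp; simpl.
    replace (CSeries n + p 0%nat + - p 0%nat)%C with (CSeries n) by ring.
    now apply CSeries_correct.
  - apply (is_series_ext (V := C_NormedModule) (fun k => p (S k))).
    intros; now rewrite Hp.
    apply (is_series_incr_1 (V := C_NormedModule)).
    unfold plus; simpl.
    replace (CSeries p - p 0%nat + p 0%nat)%C with (CSeries p) by ring.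
    now apply CSeries_correct.
Qed.

Definition reindexes (s : Z -> Z) : Prop := forall f : Z -> C, abs_summable f ->
  abs_summable (fun y => f (s y)) /\ ZSeries (fun y => f (s y)) = ZSeries f.

Lemma reindexes_opp : reindexes Z.opp.
Proof.
  intros f [F1 F2].
  destruct (half_series_move (fun k => f (Z.of_nat k)) (fun k => f (- Z.of_nat (S k))%Z)
    (fun k => f (- - Z.of_nat (S k))%Z) (fun k => f (- Z.of_nat k)%Z)) as [A [B E]]; auto.
  split; [split|].
    + exact B.
    + exact A.
    + unfold ZSeries. rewrite <- E. ring.
Qed.

Lemma reindexes_succ : reindexes Z.succ.
Proof.
  intros f [F1 F2].
  destruct (half_series_move (fun k => f (Z.of_nat k)) (fun k => f (- Z.of_nat (S k))%Z)
    (fun k => f (Z.succ (Z.of_nat k))%Z) (fun k => f (Z.succ (- Z.of_nat (S k)))%Z))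
    as [A [B E]]; auto.
  - intros k. f_equal; lia.
  - intros k. f_equal; lia.
  - split; [split|]; assumption.
Qed.

Lemma reindexes_comp (s t u : Z -> Z) : (forall y, u y = s (t y)) ->
  reindexes s -> reindexes t -> reindexes u.
Proof.
  intros E Hs Ht f Hf.
  destruct (Hs f Hf) as [A A']. destruct (Ht _ A) as [B B'].
  assert (X : forall y, f (u y) = f (s (t y))) by (intros; now rewrite E).
  split.
  - apply (abs_summable_le _ _ 1) with (2 := B). intros y. rewrite X. lra.
  - rewrite (ZSeries_ext _ _ X), B'. exact A'.
Qed.

(** Increasing or decreasing [x] by one composes [y => x - y] with a unit
    shift, on the left or on the right. *)
Lemma reindexes_sub (x : Z) : reindexes (fun y => (x - y)%Z).
Proof.
  revert x. apply Z.peano_ind.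
  - apply (reindexes_comp (fun y => y) Z.opp).
    intros; lia. intros f Hf; now split. apply reindexes_opp.
  - intros x Hx. apply (reindexes_comp Z.succ (fun y => (x - y)%Z)).
    intros; lia. apply reindexes_succ. exact Hx.
  - intros x Hx. apply (reindexes_comp (fun y => (x - y)%Z) Z.succ).
    intros; lia. exact Hx. apply reindexes_succ.
Qed.

(** * The Fourier transform and its inversion *)

Lemma Cmod_char (x t : R) : Cmod (Cexp (Ci * x * t)) = 1.
Proof. apply Cmod_Cexp_imag. simpl; ring. Qed.

Lemma Cmod_char_opp (x t : R) : Cmod (Cexp (- (Ci * x * t))) = 1.
Proof. apply Cmod_Cexp_imag. simpl; ring. Qed.

Lemma continuous_RtoC : Ccontinuous RtoC.
Proof. intros t. apply (continuous_RtoC_comp (fun t => t)). apply continuous_id. Qed.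

Lemma continuous_char (x : R) : Ccontinuous (fun t => Cexp (Ci * x * t)).
Proof.
  intros t. apply continuous_Cexp_comp. apply continuous_Cmult.
  apply continuous_const. apply continuous_RtoC.
Qed.

Lemma continuous_char_opp (x : R) : Ccontinuous (fun t => Cexp (- (Ci * x * t))).
Proof.
  intros t. apply (continuous_ext (fun t : R => Cexp ((- (Ci * x)) * t))).
  intros; f_equal; ring.
  apply continuous_Cexp_comp. apply continuous_Cmult.
  apply continuous_const. apply continuous_RtoC.
Qed.

Lemma ex_series_zpair_bound (phi : Z -> C) : abs_summable phi ->
  ex_series (fun k => Cmod (phi (Z.of_nat k)) + Cmod (phi (- Z.of_nat (S k))%Z)).
Proof. intros [P1 P2]. apply (ex_series_plus (V := R_NormedModule)); assumption. Qed.

Lemma Cmod_zpair_char (phi : Z -> C) (t : R) (k : nat) :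
  Cmod (zpair (fun x => phi x * Cexp (Ci * IZR x * t))%C k) <=
  Cmod (phi (Z.of_nat k)) + Cmod (phi (- Z.of_nat (S k))%Z).
Proof.
  unfold zpair. eapply Rle_trans; [apply Cmod_triangle|].
  rewrite !Cmod_mult, !Cmod_char. lra.
Qed.

Lemma continuous_zpair_char (phi : Z -> C) (k : nat) :
  Ccontinuous (fun t => zpair (fun x => phi x * Cexp (Ci * IZR x * t))%C k).
Proof.
  intros t. unfold zpair. apply continuous_Cplus; apply continuous_Cmult;
  (apply continuous_const || apply continuous_char).
Qed.

Lemma is_series_fourier (phi : Z -> C) (t : R) : abs_summable phi ->
  Cis_series (zpair (fun x => phi x * Cexp (Ci * IZR x * t))%C) (fourier phi t).
Proof.
  intros Hp. apply ZSeries_zpair.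
  apply (abs_summable_le _ phi 1); [|exact Hp].
  intros y. rewrite Cmod_mult, Cmod_char. lra.
Qed.

Lemma continuous_fourier (phi : Z -> C) : abs_summable phi -> Ccontinuous (fourier phi).
Proof.
  intros Hp t.
  apply (continuous_ext (fun t : R => CSeries (zpair (fun x => phi x * Cexp (Ci * IZR x * t))%C))).
  - intros u. apply CSeries_unique. now apply is_series_fourier.
  - apply (continuous_CSeries (fun k (t : R) => zpair (fun x => phi x * Cexp (Ci * IZR x * t))%C k)
      (fun k => Cmod (phi (Z.of_nat k)) + Cmod (phi (- Z.of_nat (S k))%Z))).
    + apply continuous_zpair_char.
    + intros; apply Cmod_zpair_char.
    + now apply ex_series_zpair_bound.
Qed.

Lemma Cmod_fourier_le (phi : Z -> C) (t : R) : abs_summable phi ->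
  Cmod (fourier phi t) <=
  Series (fun k => Cmod (phi (Z.of_nat k)) + Cmod (phi (- Z.of_nat (S k))%Z)).
Proof.
  intros Hp. apply Cis_series_bound with (1 := is_series_fourier phi t Hp).
  apply Cmod_zpair_char. now apply ex_series_zpair_bound.
Qed.

Lemma cos_sin_2PI_Z (z : Z) :
  cos (IZR z * (2 * PI)) = 1 /\ sin (IZR z * (2 * PI)) = 0.
Proof.
  assert (P : forall k : nat, cos (INR k * (2 * PI)) = 1 /\ sin (INR k * (2 * PI)) = 0).
  { intros k. replace (INR k * (2 * PI)) with (0 + 2 * INR k * PI) by ring.
    rewrite cos_period, sin_period, cos_0, sin_0. now split. }
  destruct (Z_le_gt_dec 0 z) as [Hz|Hz].
  - rewrite <- (Z2Nat.id z Hz), <- INR_IZR_INZ. apply P.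
  - replace z with (- Z.of_nat (Z.to_nat (- z)))%Z by lia.
    rewrite opp_IZR, <- INR_IZR_INZ, Ropp_mult_distr_l_reverse, cos_neg, sin_neg.
    destruct (P (Z.to_nat (- z))) as [-> ->]. split; ring.
Qed.

Lemma Cexp_Ci (t : R) : Cexp (Ci * t) = (cos t, sin t).
Proof.
  unfold Cexp; simpl. replace (0 * t - 1 * 0) with 0 by ring.
  replace (0 * 0 + 1 * t) with t by ring. rewrite exp_0.
  apply C_eq; simpl; ring.
Qed.

Lemma Cexp_2PI_Z (z : Z) : Cexp (Ci * IZR z * RtoC (2 * PI)) = 1%C.
Proof.
  rewrite <- Cmult_assoc, <- RtoC_mult, Cexp_Ci.
  now destruct (cos_sin_2PI_Z z) as [-> ->].
Qed.

Lemma fourier_periodic (phi : Z -> C) (t : R) : fourier phi (t + 2 * PI) = fourier phi t.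
Proof.
  apply ZSeries_ext. intros x. f_equal.
  replace (Ci * IZR x * RtoC (t + 2 * PI))%C with
    (Ci * IZR x * t + Ci * IZR x * RtoC (2 * PI))%C by (rewrite (RtoC_plus t); ring).
  rewrite Cexp_plus, Cexp_2PI_Z. ring.
Qed.

(** The period starts at an arbitrary [a]: a suitable choice will keep
    the points where [|fourier phi| = 1] away from its ends. *)
Definition inv_fourier (a : R) (h : R -> C) (x : Z) : C :=
  (RtoC (/ (2 * PI)) * CI (fun t => Cexp (- (Ci * IZR x * t)) * h t) a (a + 2 * PI))%C.

(** Orthogonality of the characters: a nontrivial one has a primitive of
    period [2 * PI]. *)
Lemma inv_fourier_1 (a : R) (x : Z) :
  inv_fourier a (fun _ => RtoC 1) x = if Z.eqb x 0 then RtoC 1 else RtoC 0.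
Proof.
  unfold inv_fourier. destruct (Z.eqb_spec x 0) as [->|Hx].
  - rewrite (CI_ext _ (fun _ => RtoC 1)).
    + rewrite (CI_unique _ _ _ (scal (a + 2 * PI - a) (RtoC 1 : C_R_NormedModule))).
      2: apply (is_RInt_const (V := C_R_NormedModule)).
      generalize PI_neq0; intros P0.
      apply C_eq; simpl; unfold scal; simpl; unfold mult; simpl; field; assumption.
    + intros t. replace (- (Ci * 0 * t))%C with (RtoC 0) by ring. rewrite Cexp_0. ring.
  - assert (X0 : IZR x <> 0) by now apply not_0_IZR.
    destruct (cos_sin_2PI_Z x) as [Ec Es].
    rewrite (CI_unique _ _ _ (RtoC 0)). ring.
    apply (is_RInt_ext (V := C_R_NormedModule)
      (fun t : R => (cos (IZR x * t), - sin (IZR x * t)))).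
    { intros t _. replace (- (Ci * IZR x * t))%C with (Ci * RtoC (- (IZR x * t)))%C
        by (rewrite RtoC_opp, RtoC_mult; ring).
      rewrite Cexp_Ci, cos_neg, sin_neg. apply C_eq; simpl; ring. }
    apply (is_RInt_fct_extend_pair (U := R_NormedModule) (V := R_NormedModule)); simpl.
    + replace 0 with (minus (sin (IZR x * (a + 2 * PI)) / IZR x) (sin (IZR x * a) / IZR x)).
      * apply (is_RInt_derive (V := R_CompleteNormedModule) (fun t => sin (IZR x * t) / IZR x)).
        -- intros t _. auto_derive. exact I. field; assumption.
        -- intros t _. apply (ex_derive_continuous (fun t => cos (IZR x * t))). auto_derive. exact I.
      * rewrite Rmult_plus_distr_l, sin_plus, Ec, Es. unfold minus, plus, opp; simpl. field; assumption.
    + replace 0 with (minus (cos (IZR x * (a + 2 * PI)) / IZR x) (cos (IZR x * a) / IZR x)).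
      * apply (is_RInt_derive (V := R_CompleteNormedModule) (fun t => cos (IZR x * t) / IZR x)).
        -- intros t _. auto_derive. exact I. field; assumption.
        -- intros t _. apply (ex_derive_continuous (fun t => - sin (IZR x * t))). auto_derive. exact I.
      * rewrite Rmult_plus_distr_l, cos_plus, Ec, Es. unfold minus, plus, opp; simpl. field; assumption.
Qed.

Lemma Cmod_inv_fourier_le (a : R) (h : R -> C) (B : R) (x : Z) :
  Ccontinuous h -> (forall t, Cmod (h t) <= B) -> Cmod (inv_fourier a h x) <= B.
Proof.
  intros Hh HB. unfold inv_fourier. pose proof PI_RGT_0 as P0.
  rewrite Cmod_mult, Cmod_R, Rabs_pos_eq.
  2: { left. apply Rinv_0_lt_compat. lra. }
  apply Rle_trans with (/ (2 * PI) * (2 * PI * B)).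
  2: right; field; lra.
  apply Rmult_le_compat_l. left; apply Rinv_0_lt_compat; lra.
  apply (Cmod_CI_le _ (fun _ => B) a (a + 2 * PI)). lra.
  - intros t. apply continuous_Cmult. apply continuous_char_opp. apply Hh.
  - intros t _. rewrite Cmod_mult, Cmod_char_opp, Rmult_1_l. apply HB.
  - replace (2 * PI * B) with (scal (a + 2 * PI - a) B).
    apply (is_RInt_const (V := R_NormedModule)).
    unfold scal; simpl; unfold mult; simpl. ring.
Qed.

(** After the change of index [y => x - y] the sum contains [phi y], and the
    factor [exp (- i (x - y) t)] under the integral splits: summing under the
    integral sign produces the Fourier series of [phi]. *)
Lemma conv_inv_fourier (phi : Z -> C) (a : R) (h : R -> C) (B : R) (x : Z) :
  abs_summable phi -> Ccontinuous h -> (forall t, Cmod (h t) <= B) ->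
  conv (inv_fourier a h) phi x = inv_fourier a (fun t => h t * fourier phi t)%C x.
Proof.
  intros Hp Hh HB. unfold conv.
  set (g := fun t : R => (Cexp (- (Ci * IZR x * t)) * h t)%C).
  assert (Hg : Ccontinuous g).
  { intros t. apply continuous_Cmult. apply continuous_char_opp. apply Hh. }
  assert (gB : forall t, Cmod (g t) <= B).
  { intros t. unfold g. rewrite Cmod_mult, Cmod_char_opp, Rmult_1_l. apply HB. }
  assert (Hc : forall y, Ccontinuous (fun t => g t * (phi y * Cexp (Ci * IZR y * t)))%C).
  { intros y t. apply continuous_Cmult. apply Hg.
    apply continuous_Cmult. apply continuous_const. apply continuous_char. }
  assert (T : forall y, (inv_fourier a h (x - y)%Z * phi y =
     RtoC (/ (2 * PI)) * CI (fun t => g t * (phi y * Cexp (Ci * IZR y * t))) a (a + 2 * PI))%C).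
  { intros y. unfold inv_fourier.
    rewrite (CI_ext (fun t : R => g t * (phi y * Cexp (Ci * IZR y * t)))%C
      (fun t : R => phi y * (Cexp (- (Ci * IZR (x - y) * t)) * h t))%C).
    - rewrite CI_scal. ring.
      intros t. apply continuous_Cmult. apply continuous_char_opp. apply Hh.
    - intros t. unfold g.
      replace (- (Ci * IZR (x - y) * t))%C with (- (Ci * IZR x * t) + Ci * IZR y * t)%C.
      rewrite Cexp_plus. ring. rewrite minus_IZR, RtoC_minus. ring. }
  assert (AS : abs_summable (fun y => inv_fourier a h (x - y)%Z * phi y)%C).
  { apply (abs_summable_le _ phi B); [|exact Hp]. intros y. rewrite Cmod_mult.
    apply Rmult_le_compat_r. apply Cmod_ge_0. now apply Cmod_inv_fourier_le. }
  destruct (reindexes_sub x _ AS) as [_ E].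
  rewrite (ZSeries_ext _ (fun y => inv_fourier a h (x - (x - y))%Z * phi (x - y)%Z)%C).
  2: { intros y. do 2 f_equal. lia. }
  rewrite E. clear E.
  rewrite <- (CSeries_unique _ _ (ZSeries_zpair _ AS)).
  rewrite (CSeries_ext _ (fun k => RtoC (/ (2 * PI)) *
    CI (fun t => g t * zpair (fun y => phi y * Cexp (Ci * IZR y * t)) k) a (a + 2 * PI))%C).
  2: { intros k. unfold zpair. rewrite !T, <- Cmult_plus_distr_l, <- CI_plus by apply Hc.
    f_equal. apply CI_ext. intros t; ring. }
  set (M := fun k => Cmod (phi (Z.of_nat k)) + Cmod (phi (- Z.of_nat (S k))%Z)).
  set (f := fun k (t : R) => (g t * zpair (fun y => phi y * Cexp (Ci * IZR y * t)) k)%C).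
  assert (Hf : forall k, Ccontinuous (f k)).
  { intros k t. apply continuous_Cmult. apply Hg. apply continuous_zpair_char. }
  assert (fM : forall k t, Cmod (f k t) <= B * M k).
  { intros k t. unfold f. rewrite Cmod_mult.
    apply Rmult_le_compat; try apply Cmod_ge_0. apply gB. apply Cmod_zpair_char. }
  assert (EM : ex_series (fun k => B * M k)).
  { apply (ex_series_scal (V := R_NormedModule) B M). now apply ex_series_zpair_bound. }
  assert (EI : CI (fun t => Cexp (- (Ci * IZR x * t)) * (h t * fourier phi t))%C a (a + 2 * PI)
     = CSeries (fun k => CI (f k) a (a + 2 * PI))).
  { rewrite <- (CSeries_CI f (fun k => B * M k) Hf fM EM).
    apply CI_ext. intros t. symmetry. apply CSeries_unique.
    replace (_ * _)%C with (g t * fourier phi t)%C by (unfold g; ring).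
    apply (is_series_scal (V := C_NormedModule) (g t)). now apply is_series_fourier. }
  unfold inv_fourier at 1. rewrite EI. apply CSeries_unique.
  apply (is_series_scal (V := C_NormedModule)). apply CSeries_correct.
  apply (ex_series_le (V := R_CompleteNormedModule) _ (fun k => 2 * PI * (B * M k))).
  2: now apply (ex_series_scal (V := R_NormedModule)).
  intros k. unfold norm; simpl. unfold abs; simpl. rewrite Rabs_pos_eq by apply Cmod_ge_0.
  apply (Cmod_CI_le _ (fun _ => B * M k) a (a + 2 * PI)).
  generalize PI_RGT_0; lra. apply Hf. intros; apply fM.
  replace (2 * PI * (B * M k)) with (scal (a + 2 * PI - a) (B * M k)).
  apply (is_RInt_const (V := R_NormedModule)).
  unfold scal; simpl; unfold mult; simpl. ring.
Qed.

Lemma inv_fourier_ext (a : R) (g h : R -> C) (x : Z) : (forall t, g t = h t) ->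
  inv_fourier a g x = inv_fourier a h x.
Proof. intros E. unfold inv_fourier. f_equal. apply CI_ext. intros; now rewrite E. Qed.

Lemma conv_unit (phi : Z -> C) (x : Z) : abs_summable phi ->
  conv (conv_pow phi 0) phi x = phi x.
Proof.
  intros Hp. unfold conv.
  rewrite (ZSeries_ext _ (fun y => if Z.eqb y 0 then phi x else 0)%C).
  2: { intros y. simpl. destruct (Z.eqb_spec y 0) as [->|]; [rewrite Z.sub_0_r|]; ring. }
  unfold ZSeries.
  rewrite (CSeries_unique _ (phi x)), (CSeries_unique _ 0). ring.
  - apply (filterlim_ext (fun _ => RtoC 0)).
    2: apply (filterlim_const (U := C_UniformSpace)).
    intros n. induction n as [|n IH]. now rewrite sum_O.
    rewrite sum_Sn, <- IH. simpl. unfold plus; simpl. ring.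
  - apply (filterlim_ext (fun _ => phi x)).
    2: apply (filterlim_const (U := C_UniformSpace)).
    intros n. induction n as [|n IH]. now rewrite sum_O.
    rewrite sum_Sn, <- IH. simpl. unfold plus; simpl. ring.
Qed.

Lemma conv_ext (f f' g : Z -> C) (x : Z) : (forall y, f y = f' y) -> conv f g x = conv f' g x.
Proof. intros E. apply ZSeries_ext. intros; now rewrite E. Qed.

(** At exponent [0] the formula is the orthogonality of the characters. As
    [phi] is the convolution of that unit with [phi], Fourier inversion for [phi]
    is the first induction step. *)
Lemma conv_pow_inv_fourier (phi : Z -> C) (a : R) (n : nat) (x : Z) : abs_summable phi ->
  conv_pow phi n x = inv_fourier a (fun t => fourier phi t ^ n)%C x.
Proof.
  intros Hp. revert x. induction n as [|n IH]; intros x.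
  - symmetry. apply inv_fourier_1.
  - transitivity (conv (conv_pow phi n) phi x).
    { destruct n. symmetry. now apply conv_unit. reflexivity. }
    rewrite (conv_ext _ _ _ _ IH).
    set (B := Series (fun k => Cmod (phi (Z.of_nat k)) + Cmod (phi (- Z.of_nat (S k))%Z))).
    rewrite (conv_inv_fourier phi a (fun t => fourier phi t ^ n)%C (B ^ n)); auto.
    + apply inv_fourier_ext. intros t. rewrite Cpow_S. ring.
    + intros t. apply continuous_Cpow. now apply continuous_fourier.
    + intros t. rewrite Cmod_pow. apply pow_incr. split. apply Cmod_ge_0.
      now apply Cmod_fourier_le.
Qed.

(** * Rapidly decaying functions *)

Lemma even_pow_ge_0 (m : nat) (u : R) : Nat.Even m -> 0 <= u ^ m.
Proof. intros [k ->]. rewrite pow_mult. apply pow_le, pow2_ge_0. Qed.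

Lemma sqr_le_even_pow (m : nat) (u : R) : (0 < m)%nat -> Nat.Even m ->
  u ^ 2 <= 1 + u ^ m.
Proof.
  intros Hm [k ->]. rewrite pow_mult. pose proof (pow2_ge_0 u) as H2.
  set (v := u ^ 2) in *. destruct (Rle_dec v 1) as [Hv|Hv].
  - pose proof (pow_le v k H2). lra.
  - assert (v ^ 1 <= v ^ k) by (apply Rle_pow; [lra | lia]). simpl in *; lra.
Qed.

Lemma exp_opp_le_inv (w : R) : 0 <= w -> exp (- w) <= / (1 + w).
Proof.
  intros Hw. rewrite exp_Ropp. apply Rinv_le_contravar. lra.
  destruct Hw as [Hw| <-]. left; now apply exp_ineq1, Rgt_not_eq.
  rewrite exp_0; lra.
Qed.

(** Combines [exp (- w) <= 1 / (1 + w)] with [u ^ 2 <= 1 + u ^ m]. Quadratic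
    decay loses much, but its integrals are explicit. *)
Lemma exp_even_pow_le (m : nat) (kappa u : R) : (0 < m)%nat -> Nat.Even m -> 0 < kappa ->
  exp (- (kappa * u ^ m)) <= (2 + / kappa) / (1 + u ^ 2).
Proof.
  intros Hm Em Hk.
  pose proof (even_pow_ge_0 m u Em). pose proof (sqr_le_even_pow m u Hm Em).
  pose proof (pow2_ge_0 u).
  assert (0 < / kappa) by now apply Rinv_0_lt_compat.
  assert (0 <= kappa * u ^ m) by (apply Rmult_le_pos; lra).
  eapply Rle_trans; [now apply exp_opp_le_inv|].
  apply Rmult_le_reg_r with ((1 + kappa * u ^ m) * (1 + u ^ 2)).
  apply Rmult_lt_0_compat; lra.
  replace (/ (1 + kappa * u ^ m) * ((1 + kappa * u ^ m) * (1 + u ^ 2))) with (1 + u ^ 2)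
    by (field; lra).
  replace ((2 + / kappa) / (1 + u ^ 2) * ((1 + kappa * u ^ m) * (1 + u ^ 2)))
    with (2 + / kappa + 2 * (kappa * u ^ m) + u ^ m) by (field; lra).
  lra.
Qed.

Lemma exp_opp_even_pow_le (m : nat) (u : R) : (0 < m)%nat -> Nat.Even m ->
  exp (- u ^ m) <= 3 / (1 + u ^ 2).
Proof.
  intros Hm Em. pose proof (exp_even_pow_le m 1 u Hm Em Rlt_0_1) as E.
  rewrite Rmult_1_l, Rinv_1 in E. replace 3 with (2 + 1) by ring. exact E.
Qed.

Lemma Rinv_1_plus_sqr_le_1 (u : R) : 0 < / (1 + u ^ 2) <= 1.
Proof.
  pose proof (pow2_ge_0 u). split. apply Rinv_0_lt_compat; lra.
  apply Rle_trans with (/ 1); [apply Rinv_le_contravar; lra | lra].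
Qed.

(** A primitive is [K / lam * atan (lam * (t - x0))], whose variation is at
    most [K / lam * PI] whatever the interval. *)
Lemma is_RInt_lorentz (K lam x0 a b : R) : 0 <= K -> 0 < lam ->
  exists l, is_RInt (fun t => K / (1 + (lam * (t - x0)) ^ 2)) a b l /\ l <= K * PI / lam.
Proof.
  intros HK Hl.
  set (F := fun t => K / lam * atan (lam * (t - x0))).
  exists (F b - F a). split.
  - apply (is_RInt_derive (V := R_CompleteNormedModule) F).
    + intros t _. unfold F. auto_derive. exact I.
      pose proof (pow2_ge_0 (lam * (t - x0))). field. split; [|lra].
      unfold Rsqr. nra.
    + intros t _. apply (ex_derive_continuous (fun t => K / (1 + (lam * (t - x0)) ^ 2))).
      pose proof (pow2_ge_0 (lam * (t - x0))). auto_derive. simpl in *. lra.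
  - unfold F. replace (K * PI / lam) with (K / lam * (PI / 2 - - (PI / 2))) by (field; lra).
    rewrite <- Rmult_minus_distr_l. apply Rmult_le_compat_l.
    apply Rdiv_le_0_compat; lra.
    destruct (atan_bound (lam * (b - x0))). destruct (atan_bound (lam * (a - x0))). lra.
Qed.

Section ImproperIntegral.

Context (f : R -> C) (K : R)
  (Hf : Ccontinuous f)
  (HK : forall u, u <> 0 -> Cmod (f u) <= K / u ^ 2).

Lemma bound_constant_ge_0 : 0 <= K.
Proof. pose proof (HK 1 R1_neq_R0). pose proof (Cmod_ge_0 (f 1)). lra. Qed.

(** The majorant [K / u ^ 2] has the primitive [- K / u] on either side of
    the origin. *)
Lemma CI_tail_ordered (T p q : R) : 0 < T -> p <= q -> (T <= p \/ q <= - T) ->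
  Cmod (CI f p q) <= K / T.
Proof.
  intros HT Hpq Hout. pose proof bound_constant_ge_0 as K0.
  apply Rle_trans with (K / p - K / q).
  - apply (Cmod_CI_le f (fun u => K / u ^ 2)); auto.
    + intros t Ht. apply HK. lra.
    + replace (K / p - K / q) with (minus (- (K / q)) (- (K / p)))
        by (unfold minus, plus, opp; simpl; ring).
      apply (is_RInt_derive (V := R_CompleteNormedModule) (fun u => - (K / u))).
      * intros t. rewrite Rmin_left, Rmax_right by assumption. intros Ht.
        auto_derive. lra. field; lra.
      * intros t. rewrite Rmin_left, Rmax_right by assumption. intros Ht.
        apply (ex_derive_continuous (fun t => K / t ^ 2)).
        auto_derive. replace (t * (t * 1)) with (t * t) by ring.
        apply Rmult_integral_contrapositive; split; lra.
  - assert (Hi : forall x, T <= x -> 0 <= K / x <= K / T).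
    { intros x Hx. split. apply Rdiv_le_0_compat; lra.
      apply Rmult_le_compat_l; [lra|]. apply Rinv_le_contravar; lra. }
    destruct Hout as [Hp|Hq].
    + pose proof (Hi p Hp). pose proof (Hi q ltac:(lra)). lra.
    + pose proof (Hi (- p) ltac:(lra)) as A. pose proof (Hi (- q) ltac:(lra)) as B.
      replace (K / - p) with (- (K / p)) in A by (field; lra).
      replace (K / - q) with (- (K / q)) in B by (field; lra). lra.
Qed.

Lemma CI_tail (T p q : R) : 0 < T -> ((T <= p /\ T <= q) \/ (p <= - T /\ q <= - T)) ->
  Cmod (CI f p q) <= K / T.
Proof.
  intros HT Hout. destruct (Rle_dec p q).
  - apply CI_tail_ordered; lra.
  - rewrite CI_swap, Cmod_opp by assumption. apply CI_tail_ordered; lra.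
Qed.

Lemma CI_cauchy (T a b a' b' : R) : 0 < T -> a <= - T -> a' <= - T -> T <= b -> T <= b' ->
  Cmod (CI f a b - CI f a' b') <= 2 * (K / T).
Proof.
  intros. rewrite (CI_Chasles f a a' b), (CI_Chasles f a' b b') by assumption.
  replace (CI f a a' + CI f a' b - (CI f a' b + CI f b b'))%C with
    (CI f a a' - CI f b b')%C by ring.
  eapply Rle_trans; [apply Cmod_triangle_minus|].
  pose proof (CI_tail T a a' ltac:(lra) ltac:(lra)).
  pose proof (CI_tail T b b' ltac:(lra) ltac:(lra)). lra.
Qed.

Lemma filter_prod_outside (T : R) :
  filter_prod (Rbar_locally m_infty) (Rbar_locally p_infty)
    (fun ab => fst ab <= - T /\ T <= snd ab).
Proof.
  apply Filter_prod with (fun a => a < - T) (fun b => T < b).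
  - now exists (- T).
  - now exists T.
  - intros a b Ha Hb. simpl. lra.
Qed.

(** The integrals over [[a, b]] satisfy the Cauchy criterion with an explicit
    rate, which the limit inherits. *)
Lemma RInt_gen_approx (T a b : R) : 0 < T -> a <= - T -> T <= b ->
  Cmod (RInt_gen (V := C_R_CompleteNormedModule) f (Rbar_locally m_infty) (Rbar_locally p_infty)
    - CI f a b) <= 2 * (K / T).
Proof.
  intros HT Ha Hb. pose proof bound_constant_ge_0 as K0.
  set (FF := filter_prod (Rbar_locally m_infty) (Rbar_locally p_infty)).
  assert (L : exists l : C, filterlim (fun ab : R * R => CI f (fst ab) (snd ab)) FF (locally l)).
  { apply (filterlim_locally_cauchy (U := C_R_CompleteNormedModule)
      (fun ab : R * R => CI f (fst ab) (snd ab))).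
    intros e. pose proof (cond_pos e) as He.
    set (S := (2 * K + 1) / e).
    assert (HS : 0 < S) by (apply Rdiv_lt_0_compat; lra).
    exists (fun ab => fst ab <= - S /\ S <= snd ab). split. apply filter_prod_outside.
    intros [p q] [p' q'] [A B] [A' B']. simpl in *.
    apply C_NormedModule_mixin_compat1.
    eapply Rle_lt_trans; [apply (CI_cauchy S); lra|].
    apply Rmult_lt_reg_r with S; [lra|].
    replace (2 * (K / S) * S) with (2 * K) by (field; lra).
    unfold S. replace (e * ((2 * K + 1) / e)) with (2 * K + 1) by (field; lra). lra. }
  destruct L as [l Hl].
  rewrite (is_RInt_gen_unique (V := C_R_CompleteNormedModule) f l).
  - apply le_epsilon. intros eps He.
    assert (X : FF (fun ab => Cmod (CI f (fst ab) (snd ab) - l) < eps)).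
    { pose proof (proj1 (filterlim_locally_ball_norm (U := C_NormedModule) _ l) Hl
        (mkposreal eps He)) as X. exact X. }
    destruct (filter_ex _ (filter_and _ _ X (filter_prod_outside T))) as [[p q] [Y [A B]]].
    simpl in *. replace (l - CI f a b)%C with ((l - CI f p q) + (CI f p q - CI f a b))%C by ring.
    eapply Rle_trans; [apply Cmod_triangle|].
    rewrite (Cmod_sym l). pose proof (CI_cauchy T p q a b). lra.
  - intros P HP. unfold filtermapi.
    generalize (Hl P HP). unfold filtermap. apply filter_imp.
    intros ab Pab. exists (CI f (fst ab) (snd ab)). split; [|exact Pab]. now apply is_CI.
Qed.

End ImproperIntegral.

(** ** The function [H] *)

Definition H_integrand (m : nat) (b y u : R) : C :=
  (Cexp (- (Ci * y * u)) * Cexp (- ((1 + Ci * b) * RtoC (u ^ m))))%C.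

Lemma continuous_pow (m : nat) (t : R) : continuous (fun u => u ^ m) t.
Proof. apply (ex_derive_continuous (fun u => u ^ m)). auto_derive. exact I. Qed.

Lemma continuous_H_integrand (m : nat) (b y : R) : Ccontinuous (H_integrand m b y).
Proof.
  intros t. apply continuous_Cmult. apply continuous_char_opp.
  apply continuous_Cexp_comp.
  apply (continuous_ext (fun u : R => (- (1 + Ci * b)) * RtoC (u ^ m))%C).
  intros u; change ((- (1 + Ci * b)) * RtoC (u ^ m) = - ((1 + Ci * b) * RtoC (u ^ m)))%C; ring. apply continuous_Cmult. apply continuous_const.
  apply continuous_RtoC_comp, continuous_pow.
Qed.

Lemma Cmod_H_integrand (m : nat) (b y u : R) : Cmod (H_integrand m b y u) = exp (- u ^ m).
Proof.
  unfold H_integrand. rewrite Cmod_mult, Cmod_char_opp, Cmod_Cexp, Rmult_1_l.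
  f_equal. simpl. ring.
Qed.

Lemma H_approx (m : nat) (b y T p q : R) : (0 < m)%nat -> Nat.Even m ->
  0 < T -> p <= - T -> T <= q ->
  Cmod (H m b y - RtoC (/ (2 * PI)) * CI (H_integrand m b y) p q) <= 6 / T.
Proof.
  intros Hm Em HT Hp Hq. pose proof PI_RGT_0 as P0. pose proof PI2_1 as P1.
  unfold H.
  replace (_ - _)%C with (RtoC (/ (2 * PI)) * (
    RInt_gen (V := C_R_CompleteNormedModule) (H_integrand m b y)
      (Rbar_locally m_infty) (Rbar_locally p_infty) - CI (H_integrand m b y) p q))%C.
  2: { unfold H_integrand; ring. }
  assert (A : forall u, u <> 0 -> Cmod (H_integrand m b y u) <= 3 / u ^ 2).
  { intros u Hu. rewrite Cmod_H_integrand.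
    eapply Rle_trans; [now apply exp_opp_even_pow_le|].
    apply Rmult_le_compat_l; [lra|].
    assert (0 < u ^ 2) by (apply pow2_gt_0; assumption).
    apply Rinv_le_contravar; lra. }
  pose proof (RInt_gen_approx (H_integrand m b y) 3
    (continuous_H_integrand m b y) A T p q HT Hp Hq) as B.
  rewrite Cmod_mult, Cmod_R, Rabs_pos_eq by (left; apply Rinv_0_lt_compat; lra).
  replace (6 / T) with (1 * (2 * (3 / T))) by (field; lra).
  apply Rmult_le_compat; auto using Cmod_ge_0.
  left; apply Rinv_0_lt_compat; lra.
  rewrite <- Rinv_1. apply Rinv_le_contravar; lra.
Qed.

(** * Powers of a function near a maximum of its modulus *)

Lemma Rpower_root_pow (m : nat) (x : R) : (0 < m)%nat -> 0 < x ->
  Rpower x (1 / INR m) ^ m = x.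
Proof.
  intros Hm Hx. rewrite <- Rpower_pow by apply exp_pos.
  rewrite Rpower_mult. replace (1 / INR m * INR m) with 1. now apply Rpower_1.
  field. apply not_0_INR; lia.
Qed.

Lemma Rabs_exp_minus_1_le (x : R) : Rabs (exp x - 1) <= Rabs x * exp (Rabs x).
Proof.
  pose proof (exp_ineq1_le x). pose proof (exp_ineq1_le (- x)) as H1.
  pose proof (exp_pos x). rewrite exp_Ropp in H1.
  destruct (Rle_dec 0 x) as [Hx|Hx].
  - rewrite !Rabs_pos_eq by lra.
    assert ((1 - x) * exp x <= / exp x * exp x) by (apply Rmult_le_compat_r; lra).
    rewrite Rinv_l in H2 by lra. lra.
  - rewrite (Rabs_left x) by lra. rewrite Rabs_left1.
    + pose proof (exp_ineq1_le (- x)).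
      assert (- x * 1 <= - x * exp (- x)) by (apply Rmult_le_compat_l; lra). lra.
    + assert (exp x <= exp 0) by (left; apply exp_increasing; lra).
      rewrite exp_0 in *. lra.
Qed.

Lemma Rabs_sin_le (y : R) : Rabs (sin y) <= Rabs y.
Proof.
  assert (P : forall z, 0 <= z -> Rabs (sin z) <= z).
  { intros z Hz. destruct (Req_dec z 0) as [->|Hz0]. rewrite sin_0, Rabs_R0; lra.
    pose proof (sin_lt_x z ltac:(lra)). pose proof (SIN_bound z). pose proof PI2_1.
    apply Rabs_le. split; [|lra].
    destruct (Rle_dec z PI) as [Hp|Hp]. pose proof (sin_ge_0 z); lra. lra. }
  destruct (Rle_dec 0 y) as [Hy|Hy].
  - rewrite (Rabs_pos_eq y) by lra. now apply P.
  - rewrite (Rabs_left y) by lra. rewrite <- Rabs_Ropp, <- sin_neg. apply P. lra.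
Qed.

Lemma Rabs_cos_minus_1_le (y : R) : Rabs (cos y - 1) <= Rabs y.
Proof.
  assert (E : cos y = 1 - 2 * sin (y / 2) * sin (y / 2)).
  { replace y with (2 * (y / 2)) at 1 by field. apply cos_2a_sin. }
  rewrite E. replace (1 - 2 * sin (y / 2) * sin (y / 2) - 1)
    with (- (2 * (sin (y / 2) * sin (y / 2)))) by ring.
  rewrite Rabs_Ropp, !Rabs_mult, (Rabs_pos_eq 2) by lra.
  pose proof (Rabs_sin_le (y / 2)) as S1. pose proof (SIN_bound (y / 2)).
  assert (S2 : Rabs (sin (y / 2)) <= 1) by (apply Rabs_le; lra).
  replace (Rabs y) with (2 * (1 * Rabs (y / 2))).
  - apply Rmult_le_compat_l; [lra|]. apply Rmult_le_compat; auto using Rabs_pos.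
  - unfold Rdiv. rewrite Rabs_mult, (Rabs_pos_eq (/ 2)) by lra. field.
Qed.

Lemma Cmod_le_abs (z : C) : Cmod z <= Rabs (Re z) + Rabs (Im z).
Proof.
  replace z with (RtoC (Re z) + Ci * RtoC (Im z))%C at 1.
  - eapply Rle_trans; [apply Cmod_triangle|].
    rewrite Cmod_mult, !Cmod_R, Cmod_Ci. lra.
  - apply C_eq; simpl; ring.
Qed.

(** With [z = x + i y], from the decomposition
    [exp z - 1 = (exp x - 1) * exp (i y) + (exp (i y) - 1)]. *)
Lemma Cmod_Cexp_minus_1_le (z : C) : Cmod (Cexp z - 1) <= 3 * Cmod z * exp (Cmod z).
Proof.
  set (x := Re z). set (y := Im z).
  assert (Hx : Rabs x <= Cmod z) by apply re_le_Cmod.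
  assert (Hy : Rabs y <= Cmod z) by apply im_le_Cmod.
  replace (Cexp z - 1)%C with
    (RtoC (exp x - 1) * Cexp (Ci * y) + ((cos y - 1)%R, sin y))%C.
  2: { rewrite Cexp_Ci. unfold Cexp. fold x y. apply C_eq; simpl; ring. }
  eapply Rle_trans; [apply Cmod_triangle|].
  assert (E : Cmod (Cexp (Ci * y)) = 1) by (apply Cmod_Cexp_imag; simpl; ring).
  rewrite Cmod_mult, E, Cmod_R.
  pose proof (Cmod_le_abs (cos y - 1, sin y)) as A; simpl in A.
  pose proof (Rabs_sin_le y). pose proof (Rabs_cos_minus_1_le y).
  pose proof (Rabs_exp_minus_1_le x) as B.
  assert (B' : Rabs x * exp (Rabs x) <= Cmod z * exp (Cmod z)).
  { apply Rmult_le_compat; auto using Rabs_pos. left; apply exp_pos.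
    destruct Hx as [Hx| ->]; [left; now apply exp_increasing | lra]. }
  pose proof (exp_ineq1_le (Cmod z)). pose proof (Cmod_ge_0 z).
  assert (Cmod z * 1 <= Cmod z * exp (Cmod z)) by (apply Rmult_le_compat_l; lra).
  lra.
Qed.

Lemma locally'_radius (P : R -> Prop) : locally' 0 P ->
  exists delta, 0 < delta /\ forall t, t <> 0 -> Rabs t < delta -> P t.
Proof.
  intros [d Hd]. exists d. split. apply cond_pos.
  intros t Ht Htd. apply Hd; [|exact Ht].
  change (Rabs (t - 0) < d). now rewrite Rminus_0_r.
Qed.

Lemma locally'_small (r : R -> C) (eta : R) : 0 < eta ->
  filterlim r (locally' 0) (locally (RtoC 0)) -> locally' 0 (fun t => Cmod (r t) < eta).
Proof.
  intros He Hr.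
  pose proof (proj1 (filterlim_locally_ball_norm (U := C_NormedModule) r (RtoC 0)) Hr
    (mkposreal eta He)) as X.
  revert X. apply filter_imp. intros t Ht.
  change (Cmod (r t - 0) < eta) in Ht. now replace (r t - 0)%C with (r t) in Ht by ring.
Qed.

(** The [n]-th power of the leading part of the expansion at a point where
    the function has the value [w]. *)
Definition model (m : nat) (w : C) (al b b' : R) (n : nat) (t : R) : C :=
  (w ^ n * Cexp (RtoC (INR n) * (Ci * al * t - (b + Ci * b') * RtoC (t ^ m))))%C.

Lemma continuous_model (m : nat) (w : C) (al b b' : R) (n : nat) :
  Ccontinuous (model m w al b b' n).
Proof.
  intros t. apply continuous_Cmult. apply continuous_const.
  apply continuous_Cexp_comp. apply continuous_Cmult. apply continuous_const.
  apply continuous_Cminus; apply continuous_Cmult; try apply continuous_const.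
  apply continuous_RtoC. apply continuous_RtoC_comp, continuous_pow.
Qed.

Lemma Cmod_model (m : nat) (w : C) (al b b' : R) (n : nat) (t : R) : Cmod w = 1 ->
  Cmod (model m w al b b' n t) = exp (- (INR n * (b * t ^ m))).
Proof.
  intros Hw. unfold model. rewrite Cmod_mult, Cmod_pow, Hw, pow1, Rmult_1_l, Cmod_Cexp.
  f_equal. simpl. ring.
Qed.

(** The relative error of the model is [|Cexp z - 1| <= 3 |z| exp |z|] with
    [z = - n beta t ^ m r(t)]. The decay [exp (- b v)] of the model, where
    [v = n t ^ m], is spent in three parts: a quarter of the exponent absorbs
    [exp |z|], a quarter absorbs the factor [v] in [|z|], and the
    remaining half gives the profile. *)
Lemma local_approx (m : nat) (f : R -> C) (x0 al b b' : R) (r : R -> C) (eps : R) :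
  (0 < m)%nat -> Nat.Even m -> 0 < b -> Cmod (f x0) = 1 ->
  filterlim r (locally' 0) (locally (RtoC 0)) ->
  locally' 0 (fun t : R => f (x0 + t) =
    (f x0 * Cexp (Ci * al * t - (b + Ci * b') * RtoC (t ^ m) * (1 + r t)))%C) ->
  0 < eps ->
  exists delta, 0 < delta /\ forall n N t, N ^ m = INR n -> Rabs t < delta ->
    Cmod (f (x0 + t)%R ^ n - model m (f x0) al b b' n t) <= eps / (1 + (N * t) ^ 2).
Proof.
  intros Hm Em Hb Hw Hr Hf He.
  set (be := (b + Ci * b')%C). set (B := Cmod be).
  assert (HB : 0 < B).
  { apply Rlt_le_trans with (1 := Hb). unfold B.
    apply Rle_trans with (2 := re_le_Cmod be). unfold be; simpl.
    apply Rle_trans with (2 := Rle_abs _). lra. }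
  set (K := 2 + / (b / 2)).
  assert (HK : 0 < K). { assert (0 < / (b / 2)) by (apply Rinv_0_lt_compat; lra). unfold K; lra. }
  (* The first bound on [r] gives [|z| <= (b / 4) v]; the second one makes
     the final constant [12 eta B / b * K] at most [eps]. *)
  set (eta := Rmin (b / (4 * B)) (eps * b / (12 * B * K))).
  assert (Heta : 0 < eta).
  { apply Rmin_pos; apply Rdiv_lt_0_compat; repeat apply Rmult_lt_0_compat; lra. }
  assert (Heta1 : eta * B <= b / 4).
  { replace (b / 4) with (b / (4 * B) * B) by (field; lra).
    apply Rmult_le_compat_r; [lra|]. apply Rmin_l. }
  assert (Heta2 : 12 * (eta * B) / b * K <= eps).
  { apply Rle_trans with (12 * (eps * b / (12 * B * K) * B) / b * K).
    2: right; field; lra.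
    apply Rmult_le_compat_r; [lra|]. apply Rmult_le_compat_r.
    left; apply Rinv_0_lt_compat; lra. apply Rmult_le_compat_l; [lra|].
    apply Rmult_le_compat_r; [lra|]. apply Rmin_r. }
  destruct (locally'_radius _ (filter_and _ _ Hf (locally'_small r eta Heta Hr)))
    as [delta [Hd Hdelta]].
  exists delta. split; [exact Hd|]. intros n N t HN Ht.
  pose proof (Rinv_1_plus_sqr_le_1 (N * t)) as HL.
  destruct (Req_dec t 0) as [->|Ht0].
  { rewrite Rplus_0_r. unfold model. rewrite pow_i by assumption.
    replace (RtoC (INR n) * (Ci * al * 0 - (b + Ci * b') * 0))%C with (RtoC 0) by ring.
    rewrite Cexp_0. replace (_ - _)%C with (RtoC 0) by ring. rewrite Cmod_0.
    apply Rmult_le_pos; lra. }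
  destruct (Hdelta t Ht0 Ht) as [Ef Hrt].
  set (v := (N * t) ^ m).
  assert (Hv : 0 <= v) by now apply even_pow_ge_0.
  assert (Ev : v = INR n * t ^ m) by (unfold v; rewrite Rpow_mult_distr, HN; ring).
  set (z := (- (RtoC v * be * r t))%C).
  assert (Hz : Cmod z <= v * (eta * B)).
  { unfold z. rewrite Cmod_opp, !Cmod_mult, Cmod_R, Rabs_pos_eq by assumption.
    rewrite Rmult_assoc. apply Rmult_le_compat_l; [assumption|].
    fold B. rewrite Rmult_comm. apply Rmult_le_compat_r; lra. }
  assert (E : (f (x0 + t)%R ^ n - model m (f x0) al b b' n t =
     model m (f x0) al b b' n t * (Cexp z - 1))%C).
  { rewrite Ef. unfold model. rewrite Cpow_mult_l, Cexp_pow.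
    replace (RtoC (INR n) * (Ci * al * t - (b + Ci * b') * RtoC (t ^ m) * (1 + r t)))%C
      with (RtoC (INR n) * (Ci * al * t - (b + Ci * b') * RtoC (t ^ m)) + z)%C.
    rewrite Cexp_plus. ring.
    unfold z, be. rewrite Ev, RtoC_mult. ring. }
  rewrite E, Cmod_mult, Cmod_model by assumption.
  replace (INR n * (b * t ^ m)) with (b * v) by (rewrite Ev; ring).
  pose proof (Cmod_Cexp_minus_1_le z) as A.
  assert (A' : 3 * Cmod z * exp (Cmod z) <= 3 * (v * (eta * B)) * exp (b / 4 * v)).
  { apply Rmult_le_compat. pose proof (Cmod_ge_0 z); lra. left; apply exp_pos. lra.
    assert (Cmod z <= b / 4 * v).
    { apply Rle_trans with (1 := Hz). rewrite Rmult_comm. now apply Rmult_le_compat_r. }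
    destruct H as [H| ->]; [left; now apply exp_increasing | lra]. }
  assert (Bv : b / 4 * v <= exp (b / 4 * v)) by (pose proof (exp_ineq1_le (b / 4 * v)); lra).
  assert (Bv' : v <= 4 / b * exp (b / 4 * v)).
  { apply Rmult_le_reg_l with (b / 4). lra.
    replace (b / 4 * (4 / b * exp (b / 4 * v))) with (exp (b / 4 * v)) by (field; lra). exact Bv. }
  pose proof (exp_even_pow_le m (b / 2) (N * t) Hm Em ltac:(lra)) as G. fold v K in G.
  apply Rle_trans with (12 * (eta * B) / b * exp (- (b / 2 * v))).
  - apply Rle_trans with (exp (- (b * v)) * (3 * ((4 / b * exp (b / 4 * v)) * (eta * B)) * exp (b / 4 * v))).
    + apply Rmult_le_compat_l. left; apply exp_pos.
      apply Rle_trans with (1 := A), Rle_trans with (1 := A').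
      apply Rmult_le_compat_r. left; apply exp_pos.
      apply Rmult_le_compat_l; [lra|]. apply Rmult_le_compat_r; [|exact Bv'].
      apply Rmult_le_pos; lra.
    + right. replace (- (b / 2 * v)) with (- (b * v) + b / 4 * v + b / 4 * v) by field.
      rewrite !exp_plus. field. lra.
  - apply Rle_trans with (12 * (eta * B) / b * (K / (1 + (N * t) ^ 2))).
    + apply Rmult_le_compat_l; [|exact G]. apply Rdiv_le_0_compat; [|lra].
      apply Rmult_le_pos; [lra|]. apply Rmult_le_pos; lra.
    + replace (12 * (eta * B) / b * (K / (1 + (N * t) ^ 2)))
        with ((12 * (eta * B) / b * K) * / (1 + (N * t) ^ 2)) by (unfold Rdiv; ring).
      apply Rmult_le_compat_r; lra.
Qed.

(** A decay exponent smaller than [m] beats [exp (- (t / eps) ^ m)] for every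
    [eps], so that the [n]-th power lives on a scale much finer than [1 / N]. *)
Lemma local_fast_decay (m : nat) (f : R -> C) (x0 mu c eps : R) :
  (0 < m)%nat -> Nat.Even m -> 0 < mu < INR m -> 0 < c -> Cmod (f x0) <= 1 ->
  locally' 0 (fun t : R => Cmod (f (x0 + t)) <= exp (- (c * Rpower (Rabs t) mu))) ->
  0 < eps ->
  exists delta, 0 < delta /\ forall n N t, N ^ m = INR n -> Rabs t < delta ->
    Cmod (f (x0 + t)%R ^ n) <= 3 / (1 + (/ eps * (N * t)) ^ 2).
Proof.
  intros Hm Em Hmu Hc Hw Hf He.
  set (k := / eps). assert (Hk : 0 < k) by now apply Rinv_0_lt_compat.
  assert (Hkm : 0 < k ^ m) by now apply pow_lt.
  destruct (locally'_radius _ Hf) as [d [Hd Hdelta]].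
  (* For [|t| <= d'] one has [|t| ^ (m - mu) <= c / k ^ m]. *)
  set (d' := Rpower (c / k ^ m) (/ (INR m - mu))).
  exists (Rmin d d'). split. apply Rmin_pos; [exact Hd | apply exp_pos].
  intros n N t HN Ht.
  assert (Htd : Rabs t < d) by (apply Rlt_le_trans with (1 := Ht), Rmin_l).
  assert (Htd' : Rabs t < d') by (apply Rlt_le_trans with (1 := Ht), Rmin_r).
  apply Rle_trans with (2 := exp_opp_even_pow_le m (k * (N * t)) Hm Em).
  rewrite Cmod_pow.
  replace (exp (- (k * (N * t)) ^ m)) with (exp (- (k * t) ^ m) ^ n).
  2: { rewrite <- Rpower_pow by apply exp_pos. unfold Rpower. rewrite ln_exp.
       f_equal. rewrite !Rpow_mult_distr, HN. ring. }
  apply pow_incr. split. apply Cmod_ge_0.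
  destruct (Req_dec t 0) as [->|Ht0].
  { rewrite Rplus_0_r, Rmult_0_r, pow_i, Ropp_0, exp_0 by assumption. exact Hw. }
  apply Rle_trans with (1 := Hdelta t Ht0 Htd).
  assert (Hta : 0 < Rabs t) by now apply Rabs_pos_lt.
  assert (X : (k * t) ^ m <= c * Rpower (Rabs t) mu).
  { replace ((k * t) ^ m) with (k ^ m * Rabs t ^ m).
    2: { rewrite Rpow_mult_distr. f_equal. destruct Em as [j ->].
         now rewrite !pow_mult, pow2_abs. }
    rewrite <- (Rpower_pow m (Rabs t)) by assumption.
    replace (INR m) with (mu + (INR m - mu)) by ring. rewrite Rpower_plus.
    assert (Y : Rpower (Rabs t) (INR m - mu) <= c / k ^ m).
    { replace (c / k ^ m) with (Rpower d' (INR m - mu)).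
      apply Rle_Rpower_l; lra.
      unfold d'. rewrite Rpower_mult. replace (/ (INR m - mu) * (INR m - mu)) with 1 by (field; lra).
      apply Rpower_1. now apply Rdiv_lt_0_compat. }
    replace (c * Rpower (Rabs t) mu) with (k ^ m * (Rpower (Rabs t) mu * (c / k ^ m))) by (field; lra).
    apply Rmult_le_compat_l; [lra|]. apply Rmult_le_compat_l; [|exact Y].
    left; apply exp_pos. }
  destruct X as [X| ->]; [left; apply exp_increasing; lra | lra].
Qed.

(** * Away from the maxima *)

Lemma continuous_Rmin_1 (g : R -> R) (t : R) : continuous g t -> continuous (fun t => Rmin 1 (g t)) t.
Proof.
  intros Hg. apply (continuous_ext (fun t => (1 + g t - Rabs (1 - g t)) * / 2)).
  - intros u. unfold Rmin, Rabs. destruct (Rle_dec 1 (g u)), (Rcase_abs (1 - g u)); lra.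
  - apply (continuous_mult (K := R_AbsRing)); [|apply continuous_const].
    apply (continuous_minus (V := R_NormedModule)).
    apply (continuous_plus (V := R_NormedModule)); [apply continuous_const|exact Hg].
    apply continuous_comp; [|apply continuous_Rabs].
    apply (continuous_minus (V := R_NormedModule)); [apply continuous_const|exact Hg].
Qed.

(** A continuous function which, as a factor, brings a function that reaches
    [1] only at the points [xi q] strictly below [1] everywhere, without
    changing it at distance at least [delta] from these points. *)
Fixpoint notch (delta : R) (xi : nat -> R) (Q : nat) (t : R) : R :=
  match Q with
  | O => 1
  | S Q' => notch delta xi Q' t * Rmin 1 (Rabs (t - xi Q) / delta)
  end.

Lemma continuous_notch (delta : R) (xi : nat -> R) (Q : nat) (t : R) :
  continuous (notch delta xi Q) t.
Proof.
  induction Q as [|Q IH]; simpl. apply continuous_const.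
  apply (continuous_mult (K := R_AbsRing)); [exact IH|].
  apply continuous_Rmin_1.
  apply (continuous_mult (K := R_AbsRing)); [|apply continuous_const].
  apply continuous_comp; [|apply continuous_Rabs].
  apply (continuous_minus (V := R_NormedModule)); [apply continuous_id|apply continuous_const].
Qed.

Lemma notch_bounds (delta : R) (xi : nat -> R) (Q : nat) (t : R) : 0 < delta ->
  0 <= notch delta xi Q t <= 1.
Proof.
  intros Hd. induction Q as [|Q IH]; simpl. lra.
  assert (0 <= Rmin 1 (Rabs (t - xi (S Q)) / delta) <= 1).
  { split. apply Rmin_glb; [lra|]. apply Rdiv_le_0_compat; [apply Rabs_pos|lra]. apply Rmin_l. }
  split. apply Rmult_le_pos; lra. apply Rle_trans with (1 * 1); [apply Rmult_le_compat|]; lra.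
Qed.

Lemma notch_at (delta : R) (xi : nat -> R) (Q q : nat) : (1 <= q <= Q)%nat ->
  notch delta xi Q (xi q) = 0.
Proof.
  induction Q as [|Q IH]; intros Hq; simpl. lia.
  destruct (Nat.eq_dec q (S Q)) as [->|Hne].
  - replace (xi (S Q) - xi (S Q)) with 0 by ring. rewrite Rabs_R0.
    unfold Rdiv; rewrite Rmult_0_l, Rmin_right by lra. ring.
  - rewrite IH by lia. ring.
Qed.

Lemma notch_far (delta : R) (xi : nat -> R) (Q : nat) (t : R) : 0 < delta ->
  (forall q, (1 <= q <= Q)%nat -> delta <= Rabs (t - xi q)) -> notch delta xi Q t = 1.
Proof.
  intros Hd. induction Q as [|Q IH]; intros Hq; simpl. reflexivity.
  rewrite IH by (intros; apply Hq; lia). rewrite Rmin_left. ring.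
  apply Rmult_le_reg_r with delta; [exact Hd|].
  unfold Rdiv; rewrite Rmult_assoc, Rinv_l by lra.
  rewrite Rmult_1_l, Rmult_1_r. apply Hq; lia.
Qed.

(** The product of [g] with [notch] is continuous and stays below [1] on the
    compact interval, where it attains its maximum. *)
Lemma uniform_gap (g : R -> R) (a b delta : R) (xi : nat -> R) (Q : nat) :
  a <= b -> 0 < delta -> (forall t, continuous g t) -> (forall t, 0 <= g t) ->
  (forall t, a <= t <= b -> (forall q, (1 <= q <= Q)%nat -> t <> xi q) -> g t < 1) ->
  exists kappa, 0 < kappa /\ forall t, a <= t <= b ->
    (forall q, (1 <= q <= Q)%nat -> delta <= Rabs (t - xi q)) -> g t <= exp (- kappa).
Proof.
  intros Hab Hd Hg Hg0 Hg1.
  destruct (continuity_ab_maj (fun t => g t * notch delta xi Q t) a b Hab) as [M [HM HMab]].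
  { intros t _. apply continuity_pt_filterlim.
    apply (continuous_mult (K := R_AbsRing)); [apply Hg|apply continuous_notch]. }
  set (rho := g M * notch delta xi Q M) in HM.
  assert (Hrho : rho < 1).
  { unfold rho. pose proof (notch_bounds delta xi Q M Hd).
    destruct (Classical_Prop.classic (exists q, (1 <= q <= Q)%nat /\ M = xi q)) as [[q [Hq E]]|Hn].
    - rewrite E at 2. rewrite notch_at by assumption. lra.
    - assert (g M < 1). { apply Hg1; [lra|]. intros q Hq E. apply Hn. now exists q. }
      apply Rle_lt_trans with (g M * 1); [|lra]. apply Rmult_le_compat_l; [apply Hg0|lra]. }
  assert (Hr : 0 < Rmax rho (/ 2) < 1).
  { split. apply Rlt_le_trans with (/ 2); [lra|apply Rmax_r]. apply Rmax_lub_lt; lra. }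
  (* The maximum [rho] may be [0]; the lower bound [1 / 2] keeps the logarithm
     meaningful. *)
  exists (- ln (Rmax rho (/ 2))). split.
  - assert (ln (Rmax rho (/ 2)) < ln 1) by (apply ln_increasing; lra). rewrite ln_1 in *. lra.
  - intros t Ht Hfar. rewrite Ropp_involutive, exp_ln by lra.
    apply Rle_trans with (2 := Rmax_l _ _). specialize (HM t Ht).
    now rewrite notch_far, Rmult_1_r in HM by assumption.
Qed.

(** * Comparison with the sum of the models *)

(** Smallness conditions attached to finitely many points can be met by one
    number. *)
Lemma finite_radius (n : nat) (P : nat -> R -> Prop) :
  (forall q, (1 <= q <= n)%nat ->
    exists delta, 0 < delta /\ forall d, 0 < d <= delta -> P q d) ->
  exists delta, 0 < delta /\ forall d, 0 < d <= delta ->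
    forall q, (1 <= q <= n)%nat -> P q d.
Proof.
  induction n as [|n IH]; intros HP.
  - exists 1. split. lra. intros; lia.
  - destruct IH as [d1 [Hd1 H1]]. intros; apply HP; lia.
    destruct (HP (S n) ltac:(lia)) as [d2 [Hd2 H2]].
    exists (Rmin d1 d2). split. now apply Rmin_pos.
    intros d Hd q Hq. pose proof (Rmin_l d1 d2). pose proof (Rmin_r d1 d2).
    destruct (Nat.eq_dec q (S n)) as [->|]. apply H2; lra. apply H1; [lra|lia].
Qed.

Lemma sum_R_Sm (W : nat -> R) (n : nat) :
  sum_n_m W 1 (S n) = sum_n_m W 1 n + W (S n).
Proof. apply (sum_n_Sm (G := R_AbelianMonoid)). lia. Qed.

Lemma sum_R_0 (W : nat -> R) : sum_n_m W 1 0 = 0.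
Proof. apply (sum_n_m_zero (G := R_AbelianMonoid)). lia. Qed.

Lemma sum_R_ge_0 (W : nat -> R) (n : nat) : (forall q, 0 <= W q) -> 0 <= sum_n_m W 1 n.
Proof.
  intros HW. induction n as [|n IH]. rewrite sum_R_0; lra.
  rewrite sum_R_Sm. specialize (HW (S n)). lra.
Qed.

Lemma term_le_sum_R (W : nat -> R) (n q : nat) : (forall q, 0 <= W q) ->
  (1 <= q <= n)%nat -> W q <= sum_n_m W 1 n.
Proof.
  intros HW. induction n as [|n IH]; intros Hq. lia.
  rewrite sum_R_Sm. pose proof (sum_R_ge_0 W n HW). pose proof (HW (S n)).
  destruct (Nat.eq_dec q (S n)) as [->|]. lra. assert (W q <= sum_n_m W 1 n) by (apply IH; lia). lra.
Qed.

Lemma is_RInt_sum_le (W : nat -> R -> R) (n : nat) (a b B : R) :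
  (forall q, (1 <= q <= n)%nat -> exists l, is_RInt (W q) a b l /\ l <= B) ->
  exists l, is_RInt (fun t => sum_n_m (fun q => W q t) 1 n) a b l /\ l <= INR n * B.
Proof.
  induction n as [|n IH]; intros HW.
  - exists (scal (b - a) 0). split.
    + apply (is_RInt_ext (fun _ => 0)). intros; now rewrite sum_R_0.
      apply (is_RInt_const (V := R_NormedModule)).
    + right. unfold scal; simpl; unfold mult; simpl. ring.
  - destruct IH as [l [I L]]. intros; apply HW; lia.
    destruct (HW (S n) ltac:(lia)) as [l' [I' L']].
    exists (l + l'). split.
    + apply (is_RInt_ext (fun t => sum_n_m (fun q => W q t) 1 n + W (S n) t)).
      intros; now rewrite sum_R_Sm.
      apply (is_RInt_plus (V := R_NormedModule)); assumption.
    + rewrite S_INR. lra.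
Qed.

(** The sum of the error bounds of [local_approx] and [local_fast_decay], so
    that both kinds of points are treated alike. *)
Definition profile (eps s : R) : R := eps / (1 + s ^ 2) + 3 / (1 + (/ eps * s) ^ 2).

Lemma profile_ge (eps s : R) : 0 < eps ->
  eps / (1 + s ^ 2) <= profile eps s /\ 3 / (1 + (/ eps * s) ^ 2) <= profile eps s /\
  0 <= profile eps s.
Proof.
  intros He. unfold profile.
  pose proof (Rinv_1_plus_sqr_le_1 s). pose proof (Rinv_1_plus_sqr_le_1 (/ eps * s)).
  assert (0 <= eps / (1 + s ^ 2)) by (apply Rmult_le_pos; lra).
  assert (0 <= 3 / (1 + (/ eps * s) ^ 2)) by (apply Rmult_le_pos; lra).
  lra.
Qed.

Lemma is_RInt_profile (eps N x0 a b : R) : 0 < eps -> 0 < N ->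
  exists l, is_RInt (fun t => profile eps (N * (t - x0))) a b l /\ l <= 4 * PI * eps / N.
Proof.
  intros He HN.
  destruct (is_RInt_lorentz eps N x0 a b) as [l [I L]]; [lra|lra|].
  destruct (is_RInt_lorentz 3 (/ eps * N) x0 a b) as [l' [I' L']]; [lra| |].
  { apply Rmult_lt_0_compat; [now apply Rinv_0_lt_compat|lra]. }
  exists (l + l'). split.
  - apply (is_RInt_ext (fun t => eps / (1 + (N * (t - x0)) ^ 2) +
      3 / (1 + (/ eps * N * (t - x0)) ^ 2))).
    intros t _. unfold profile. now rewrite Rmult_assoc.
    apply (is_RInt_plus (V := R_NormedModule)); assumption.
  - replace (4 * PI * eps / N) with (eps * PI / N + 3 * PI / (/ eps * N)) by (field; lra). lra.
Qed.

Lemma exp_pow_n (x : R) (n : nat) : exp x ^ n = exp (INR n * x).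
Proof. rewrite <- Rpower_pow by apply exp_pos. unfold Rpower. now rewrite ln_exp. Qed.

Lemma exp_le (x y : R) : x <= y -> exp x <= exp y.
Proof. intros [Hxy| ->]; [left; now apply exp_increasing | lra]. Qed.

Lemma Cmod_model_far (m : nat) (w : C) (al b b' : R) (n : nat) (delta kappa t : R) :
  Nat.Even m -> Cmod w = 1 -> 0 < delta -> 0 < b -> kappa <= b * delta ^ m ->
  delta <= Rabs t -> Cmod (model m w al b b' n t) <= exp (- (INR n * kappa)).
Proof.
  intros [j ->] Hw Hd Hb Hk Ht. rewrite Cmod_model by assumption.
  apply exp_le, Ropp_le_contravar, Rmult_le_compat_l. apply pos_INR.
  apply Rle_trans with (1 := Hk). apply Rmult_le_compat_l; [lra|].
  replace (t ^ (2 * j)) with (Rabs t ^ (2 * j)) by now rewrite !pow_mult, pow2_abs.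
  apply pow_incr. lra.
Qed.

(** The models need not be cut off. In the window around [xi q] all the
    other models are exponentially small, because the windows are disjoint;
    outside of the windows this holds for all the models and for [f ^ n]. *)
Lemma error_majorant (m : nat) (f : R -> C) (Q Q1 : nat) (xi al b b' : nat -> R)
  (eps delta kappa a c N : R) (n : nat) :
  Nat.Even m -> (Q1 <= Q)%nat -> 0 < eps -> 0 < delta ->
  (forall q, (1 <= q <= Q1)%nat -> Cmod (f (xi q)) = 1) ->
  (forall q, (1 <= q <= Q1)%nat -> 0 < b q /\ kappa <= b q * delta ^ m) ->
  (forall p q, (1 <= p <= Q)%nat -> (1 <= q <= Q)%nat -> p <> q ->
     2 * delta <= Rabs (xi p - xi q)) ->
  (forall q t, (1 <= q <= Q1)%nat -> Rabs t < delta ->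
     Cmod (f (xi q + t)%R ^ n - model m (f (xi q)) (al q) (b q) (b' q) n t)
     <= eps / (1 + (N * t) ^ 2)) ->
  (forall q t, (Q1 + 1 <= q <= Q)%nat -> Rabs t < delta ->
     Cmod (f (xi q + t)%R ^ n) <= 3 / (1 + (/ eps * (N * t)) ^ 2)) ->
  (forall t, a <= t <= c -> (forall q, (1 <= q <= Q)%nat -> delta <= Rabs (t - xi q)) ->
     Cmod (f t) <= exp (- kappa)) ->
  forall t, a <= t <= c ->
  Cmod (f t ^ n - Csum (fun q => model m (f (xi q)) (al q) (b q) (b' q) n (t - xi q)) Q1)
  <= sum_n_m (fun q => profile eps (N * (t - xi q))) 1 Q
     + (INR Q1 + 1) * exp (- (INR n * kappa)).
Proof.
  intros Em HQ He Hd Hw Hb Hsep Hnear Hfast Hfar t Ht.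
  set (E := fun q => model m (f (xi q)) (al q) (b q) (b' q) n (t - xi q)).
  set (W := fun q => profile eps (N * (t - xi q))).
  set (rho := exp (- (INR n * kappa))).
  assert (Hrho : 0 < rho) by apply exp_pos.
  assert (HW : forall q, 0 <= W q) by (intros q; now apply profile_ge).
  assert (HE : forall q, (1 <= q <= Q1)%nat -> delta <= Rabs (t - xi q) -> Cmod (E q) <= rho).
  { intros q Hq Hqt. destruct (Hb q Hq). apply Cmod_model_far with delta; auto. }
  destruct (Classical_Prop.classic (exists q, (1 <= q <= Q)%nat /\ Rabs (t - xi q) < delta))
    as [[q [Hq Hqt]]|Hnone].
  - assert (Hother : forall p, (1 <= p <= Q)%nat -> p <> q -> delta <= Rabs (t - xi p)).
    { intros p Hp Hpq. specialize (Hsep p q Hp Hq Hpq).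
      replace (xi p - xi q) with ((t - xi q) - (t - xi p)) in Hsep by ring.
      pose proof (Rabs_triang (t - xi q) (- (t - xi p))) as T. rewrite Rabs_Ropp in T.
      unfold Rminus at 1 in Hsep. lra. }
    pose proof (term_le_sum_R W Q q HW Hq) as Hterm.
    destruct (profile_ge eps (N * (t - xi q)) He) as [P1 [P2 _]]. fold (W q) in P1, P2.
    replace (f t) with (f (xi q + (t - xi q))) by (f_equal; ring).
    destruct (le_lt_dec q Q1) as [Hq1|Hq1].
    + replace (_ - _)%C with ((f (xi q + (t - xi q))%R ^ n - E q) - (Csum E Q1 - E q))%C by ring.
      eapply Rle_trans; [apply Cmod_triangle_minus|].
      assert (A : Cmod (f (xi q + (t - xi q))%R ^ n - E q) <= W q).
      { eapply Rle_trans; [|exact P1]. apply Hnear; [lia|assumption]. }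
      assert (B : Cmod (Csum E Q1 - E q) <= INR Q1 * rho).
      { apply Cmod_sum_minus_term_le; [lra|lia|]. intros p Hp Hpq. apply HE; [lia|].
        apply Hother; [lia|assumption]. }
      lra.
    + eapply Rle_trans; [apply Cmod_triangle_minus|].
      assert (A : Cmod (f (xi q + (t - xi q))%R ^ n) <= W q).
      { eapply Rle_trans; [|exact P2]. apply Hfast; [lia|assumption]. }
      assert (B : Cmod (Csum E Q1) <= INR Q1 * rho).
      { apply Cmod_sum_le. intros p Hp. apply HE; [lia|]. apply Hother; lia. }
      lra.
  - assert (Hall : forall q, (1 <= q <= Q)%nat -> delta <= Rabs (t - xi q)).
    { intros q Hq. apply Rnot_lt_le. intros X. apply Hnone. now exists q. }
    eapply Rle_trans; [apply Cmod_triangle_minus|].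
    assert (A : Cmod (f t ^ n) <= rho).
    { rewrite Cmod_pow. unfold rho.
      replace (- (INR n * kappa)) with (INR n * - kappa) by ring. rewrite <- exp_pow_n.
      apply pow_incr. split; [apply Cmod_ge_0|now apply Hfar]. }
    assert (B : Cmod (Csum E Q1) <= INR Q1 * rho).
    { apply Cmod_sum_le. intros p Hp. apply HE; [lia|]. apply Hall; lia. }
    pose proof (sum_R_ge_0 W Q HW). lra.
Qed.

Definition main_term (m : nat) (w : C) (x0 al b b' : R) (n : nat) (x : Z) : C :=
  (RtoC (Rpower (b * INR n) (- (1 / INR m))) * Cexp (- (Ci * IZR x * x0)) * w ^ n *
   H m (b' / b) ((IZR x - al * INR n) * Rpower (b * INR n) (- (1 / INR m))))%C.

(** The substitution [u = (b n) ^ (1 / m) (t - x0)] turns the model into the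
    integrand of [H], on an interval that contains [[- T, T]] for
    [T = (b n) ^ (1 / m) tau]. The square in the bound combines [1 / T] from
    the truncation and the prefactor of [H]. *)
Lemma inv_fourier_model (m : nat) (w : C) (x0 al b b' a tau : R) (n : nat) (x : Z) :
  (0 < m)%nat -> Nat.Even m -> Cmod w = 1 -> 0 < b -> 0 < INR n ->
  0 < tau -> a <= x0 - tau -> x0 + tau <= a + 2 * PI ->
  Cmod (inv_fourier a (fun t => model m w al b b' n (t - x0)) x
        - main_term m w x0 al b b' n x)
  <= 6 / (tau * (Rpower b (1 / INR m) * Rpower (INR n) (1 / INR m)) ^ 2).
Proof.
  intros Hm Em Hw Hb Hn Htau Ha Hc.
  rewrite Rpower_mult_distr by assumption.
  set (S := Rpower (b * INR n) (1 / INR m)).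
  assert (HS : 0 < S) by apply exp_pos.
  assert (HSm : S ^ m = b * INR n) by (apply Rpower_root_pow; [assumption|now apply Rmult_lt_0_compat]).
  unfold main_term. rewrite Rpower_Ropp. fold S.
  set (y := (IZR x - al * INR n) * / S).
  assert (Hy : y * S = IZR x - al * INR n) by (unfold y; field; lra).
  clearbody y.
  set (h := H_integrand m (b' / b) y).
  assert (Hh : Ccontinuous h) by apply continuous_H_integrand.
  set (g := fun t : R => (RtoC S * h (S * t + - (S * x0))%R)%C).
  set (k := (RtoC (/ S) * Cexp (- (Ci * IZR x * x0)) * w ^ n)%C).
  assert (HSC : RtoC S <> 0%C) by (intros X; apply RtoC_inj in X; lra).
  assert (HbC : RtoC b <> 0%C) by (intros X; apply RtoC_inj in X; lra).
  assert (Hg : forall t : R, (Cexp (- (Ci * IZR x * t)) * model m w al b b' n (t - x0) = k * g t)%C).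
  { intros t. unfold g, k, h, H_integrand, model.
    replace (S * t + - (S * x0)) with (S * (t - x0)) by ring.
    rewrite Rpow_mult_distr, HSm.
    replace (- (Ci * IZR x * t))%C with (- (Ci * IZR x * x0) + - (Ci * IZR x * RtoC (t - x0)))%C
      by (rewrite RtoC_minus; ring).
    replace (- (Ci * y * RtoC (S * (t - x0))))%C with
      (- (Ci * IZR x * RtoC (t - x0)) + RtoC (INR n) * (Ci * al * RtoC (t - x0)))%C.
    2: { transitivity (- (Ci * RtoC (y * S) * RtoC (t - x0)))%C.
         rewrite Hy, !RtoC_minus, RtoC_mult; ring. rewrite !RtoC_mult; ring. }
    replace (- ((1 + Ci * (b' / b)%R) * RtoC (b * INR n * (t - x0) ^ m)))%C with
      (- (RtoC (INR n) * ((b + Ci * b') * RtoC ((t - x0) ^ m))))%C.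
    2: { rewrite RtoC_div, !RtoC_mult by lra. field. exact HbC. }
    replace (RtoC (INR n) * (Ci * al * RtoC (t - x0) - (b + Ci * b') * RtoC ((t - x0) ^ m)))%C with
      (RtoC (INR n) * (Ci * al * RtoC (t - x0)) +
        - (RtoC (INR n) * ((b + Ci * b') * RtoC ((t - x0) ^ m))))%C by ring.
    rewrite RtoC_inv, !Cexp_plus by lra. field. exact HSC. }
  assert (Cg : Ccontinuous g).
  { intros t. apply continuous_Cmult. apply continuous_const.
    apply (continuous_comp (fun t => S * t + - (S * x0)) h); [|apply Hh].
    apply (ex_derive_continuous (fun t => S * t + - (S * x0))). auto_derive. exact I. }
  unfold inv_fourier. rewrite (CI_ext _ _ _ _ Hg), CI_scal by assumption.
  rewrite (CI_affine h g S (- (S * x0)) a (a + 2 * PI) Hh) by reflexivity.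
  fold k.
  replace (RtoC (/ (2 * PI)) * (k * CI h (S * a + - (S * x0)) (S * (a + 2 * PI) + - (S * x0)))
     - k * H m (b' / b) y)%C with
    (k * (RtoC (/ (2 * PI)) * CI h (S * a + - (S * x0)) (S * (a + 2 * PI) + - (S * x0))
     - H m (b' / b) y))%C by ring.
  rewrite Cmod_mult, Cmod_sym.
  assert (Hk : Cmod k = / S).
  { unfold k. rewrite !Cmod_mult, Cmod_char_opp, Cmod_pow, Hw, pow1, Cmod_R, Rabs_pos_eq.
    ring. left; now apply Rinv_0_lt_compat. }
  rewrite Hk.
  replace (6 / (tau * S ^ 2)) with (/ S * (6 / (S * tau))) by (field; lra).
  apply Rmult_le_compat_l. left; now apply Rinv_0_lt_compat.
  apply H_approx; auto.
  - now apply Rmult_lt_0_compat.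
  - assert (S * a <= S * (x0 - tau)) by (apply Rmult_le_compat_l; lra). lra.
  - assert (S * (x0 + tau) <= S * (a + 2 * PI)) by (apply Rmult_le_compat_l; lra). lra.
Qed.

Lemma inv_fourier_sum (a : R) (E : nat -> R -> C) (n : nat) (x : Z) :
  (forall q, Ccontinuous (E q)) ->
  inv_fourier a (fun t => Csum (fun q => E q t) n) x =
  Csum (fun q => inv_fourier a (E q) x) n.
Proof.
  intros HE. induction n as [|n IH].
  - rewrite sum_C_0. unfold inv_fourier.
    rewrite (CI_ext _ (fun t => 0 * 0)%C).
    2: { intros t. rewrite sum_C_0. ring. }
    rewrite CI_scal. ring. intros t; apply continuous_const.
  - rewrite sum_C_Sm, <- IH. unfold inv_fourier.
    rewrite <- Cmult_plus_distr_l, <- CI_plus.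
    + f_equal. apply CI_ext. intros t. rewrite sum_C_Sm. ring.
    + intros t. apply continuous_Cmult. apply continuous_char_opp.
      now apply continuous_Csum.
    + intros t. apply continuous_Cmult. apply continuous_char_opp. apply HE.
Qed.

(** The characters have modulus [1]: this is why the final estimate is
    uniform in [x]. *)
Lemma inv_fourier_diff_le (a : R) (g h : R -> C) (G : R -> R) (l : R) (x : Z) :
  Ccontinuous g -> Ccontinuous h ->
  (forall t, a <= t <= a + 2 * PI -> Cmod (g t - h t) <= G t) ->
  is_RInt G a (a + 2 * PI) l ->
  Cmod (inv_fourier a g x - inv_fourier a h x) <= / (2 * PI) * l.
Proof.
  intros Hg Hh HG I. pose proof PI_RGT_0 as P0. unfold inv_fourier.
  assert (X : forall k, Ccontinuous k -> Ccontinuous (fun t : R => Cexp (- (Ci * IZR x * t)) * k t)%C).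
  { intros k Hk t. apply continuous_Cmult. apply continuous_char_opp. apply Hk. }
  replace (_ - _)%C with (RtoC (/ (2 * PI)) *
    (CI (fun t : R => Cexp (- (Ci * IZR x * t)) * g t) a (a + 2 * PI) -
     CI (fun t : R => Cexp (- (Ci * IZR x * t)) * h t) a (a + 2 * PI)))%C by ring.
  rewrite <- CI_minus by auto.
  rewrite Cmod_mult, Cmod_R, Rabs_pos_eq by (left; apply Rinv_0_lt_compat; lra).
  apply Rmult_le_compat_l. left; apply Rinv_0_lt_compat; lra.
  apply (Cmod_CI_le _ G a (a + 2 * PI)); auto. lra.
  - intros t. apply continuous_Cminus; now apply X.
  - intros t Ht. replace (_ - _)%C with (Cexp (- (Ci * IZR x * t)) * (g t - h t))%C by ring.
    rewrite Cmod_mult, Cmod_char_opp, Rmult_1_l. now apply HG.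
Qed.

Lemma eventually_root_ge (m : nat) (X : R) : (0 < m)%nat -> 0 < X ->
  eventually (fun n => (1 <= n)%nat /\ X <= Rpower (INR n) (1 / INR m)).
Proof.
  intros Hm HX. destruct (nfloor_ex (X ^ m)) as [n0 Hn0]. left; now apply pow_lt.
  exists (S n0). intros n Hn. split. lia.
  assert (X ^ m <= INR n).
  { apply Rle_trans with (INR (S n0)). rewrite S_INR; lra. now apply le_INR. }
  assert (Hm' : 0 < INR m) by (apply lt_0_INR; lia).
  replace X with (Rpower (X ^ m) (1 / INR m)) at 1.
  - apply Rle_Rpower_l. left; apply Rdiv_lt_0_compat; lra.
    split; [now apply pow_lt|assumption].
  - rewrite <- Rpower_pow, Rpower_mult by assumption.
    replace (INR m * (1 / INR m)) with 1 by (field; lra). now apply Rpower_1.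
Qed.

(* The points xi_q and the parameters attached to them are indexed by the
   natural numbers 1 <= q <= Q; values at other indices are irrelevant.
   Asymptotic hypotheses as xi -> 0 are on punctured neighbourhoods
   (locally' 0): at xi = 0 they hold trivially, but Rpower 0 mu is not 0. *)
Theorem theorem2p3
  (phi : Z -> C)
  (Hsum : abs_summable phi)
  (Hle1 : forall theta : R, - PI <= theta <= PI -> Cmod (fourier phi theta) <= 1)
  (Q : nat) (xi : nat -> R)
  (Hxi_range : forall q, (1 <= q <= Q)%nat -> - PI < xi q <= PI)
  (Hxi_distinct : forall p q, (1 <= p <= Q)%nat -> (1 <= q <= Q)%nat ->
     xi p = xi q -> p = q)
  (Hxi_one : forall q, (1 <= q <= Q)%nat -> Cmod (fourier phi (xi q)) = 1)
  (Hlt1 : forall theta : R, - PI < theta <= PI ->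
     (forall q, (1 <= q <= Q)%nat -> theta <> xi q) ->
     Cmod (fourier phi theta) < 1)
  (Q1 : nat) (HQ1 : (Q1 <= Q)%nat)
  (m : nat) (Hm_pos : (0 < m)%nat) (Hm_even : Nat.Even m)
  (alpha b b' : nat -> R)
  (Hb : forall q, (1 <= q <= Q1)%nat -> 0 < b q)
  (Hasymp : forall q, (1 <= q <= Q1)%nat ->
     exists r : R -> C,
       filterlim r (locally' 0) (locally (RtoC 0)) /\
       locally' 0 (fun t : R =>
         fourier phi (xi q + t) =
         (fourier phi (xi q) *
          Cexp (Ci * alpha q * t
                - (b q + Ci * b' q) * RtoC (t ^ m) * (1 + r t)))%C))
  (mu : R) (Hmu : 0 < mu < INR m)
  (c : nat -> R)
  (Hc : forall q, (Q1 + 1 <= q <= Q)%nat -> 0 < c q)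
  (Hdecay : forall q, (Q1 + 1 <= q <= Q)%nat ->
     locally' 0 (fun t : R =>
       Cmod (fourier phi (xi q + t)) <= exp (- (c q * Rpower (Rabs t) mu)))) :
  forall eps : R, 0 < eps ->
  eventually (fun n : nat => forall x : Z,
    Cmod (conv_pow phi n x
          - sum_n_m (G := C_AbelianMonoid)
              (fun q : nat =>
                 RtoC (Rpower (b q * INR n) (- (1 / INR m)))
                 * Cexp (- (Ci * IZR x * xi q))
                 * fourier phi (xi q) ^ n
                 * H m (b' q / b q)
                     ((IZR x - alpha q * INR n)
                      * Rpower (b q * INR n) (- (1 / INR m))))
              1 Q1)%C
    <= eps * Rpower (INR n) (- (1 / INR m))).
Proof.
  intros eps Heps. pose proof PI_RGT_0 as HPI.
  set (f := fourier phi) in *.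
  assert (Cf : Ccontinuous f) by now apply continuous_fourier.
  destruct (finite_radius Q (fun q d => - PI + d < xi q)) as [eta0 [Heta0 Ha]].
  { intros q Hq. specialize (Hxi_range q Hq). exists ((xi q + PI) / 2).
    split; [lra|]. intros; lra. }
  (* Starting the period slightly to the right of [- PI] puts all the points in
     its interior, even a point at [PI]. For [t > PI] in this period, [t - 2 PI]
     lies between [- PI] and the first point; [eta <= PI] ensures that it is in
     the basic period. *)
  set (eta := Rmin eta0 PI).
  assert (Heta : 0 < eta <= eta0 /\ eta <= PI).
  { unfold eta. split; [split|]; [now apply Rmin_pos|apply Rmin_l|apply Rmin_r]. }
  set (a := - PI + eta).
  assert (Hxia : forall q, (1 <= q <= Q)%nat -> a < xi q < a + 2 * PI).
  { intros q Hq. specialize (Hxi_range q Hq). specialize (Ha eta ltac:(lra) q Hq).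
    unfold a. lra. }
  destruct (finite_radius Q (fun q d => a <= xi q - d /\ xi q + d <= a + 2 * PI))
    as [tau [Htau Hwin]].
  { intros q Hq. specialize (Hxia q Hq). exists (Rmin (xi q - a) (a + 2 * PI - xi q)).
    split. apply Rmin_pos; lra. intros d Hd.
    pose proof (Rmin_l (xi q - a) (a + 2 * PI - xi q)).
    pose proof (Rmin_r (xi q - a) (a + 2 * PI - xi q)). lra. }
  specialize (Hwin tau ltac:(lra)).
  pose proof (pos_INR Q) as HQ0. pose proof (pos_INR Q1) as HQ10.
  (* The [Q] profiles contribute [Q * (4 PI eps1 / N)] to the integral, which
     divided by [2 PI] is at most [(eps / 2) / N]. *)
  set (eps1 := eps / (4 * (INR Q + 1))).
  assert (Heps1 : 0 < eps1) by (apply Rdiv_lt_0_compat; lra).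
  destruct (finite_radius Q (fun q d =>
    (forall p, (1 <= p <= Q)%nat -> p <> q -> 2 * d <= Rabs (xi p - xi q)) /\
    ((q <= Q1)%nat -> forall n N t, N ^ m = INR n -> Rabs t < d ->
      Cmod (f (xi q + t)%R ^ n - model m (f (xi q)) (alpha q) (b q) (b' q) n t)
      <= eps1 / (1 + (N * t) ^ 2)) /\
    ((Q1 + 1 <= q)%nat -> forall n N t, N ^ m = INR n -> Rabs t < d ->
      Cmod (f (xi q + t)%R ^ n) <= 3 / (1 + (/ eps1 * (N * t)) ^ 2))))
    as [delta [Hdelta Hlocal]].
  { intros q Hq.
    destruct (finite_radius Q (fun p d => p <> q -> 2 * d <= Rabs (xi p - xi q)))
      as [d1 [Hd1 H1]].
    { intros p Hp. destruct (Nat.eq_dec p q) as [->|Hpq].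
      - exists 1. split; [lra|]. intros; congruence.
      - assert (0 < Rabs (xi p - xi q)).
        { apply Rabs_pos_lt. intros X. apply Hpq, Hxi_distinct; auto. lra. }
        exists (Rabs (xi p - xi q) / 2). split; [lra|]. intros; lra. }
    destruct (le_lt_dec q Q1) as [Hq1|Hq1].
    - destruct (Hasymp q ltac:(lia)) as [r [Hr Hexp]].
      destruct (local_approx m f (xi q) (alpha q) (b q) (b' q) r eps1) as [d2 [Hd2 H2]];
        auto. { apply Hb; lia. }
      exists (Rmin d1 d2). split. now apply Rmin_pos.
      intros d Hd. pose proof (Rmin_l d1 d2). pose proof (Rmin_r d1 d2). split; [|split].
      + intros p Hp Hpq. apply H1; auto; lra.
      + intros _ n N t HN Ht. apply H2; auto; lra.
      + intros; lia.
    - destruct (local_fast_decay m f (xi q) mu (c q) eps1) as [d2 [Hd2 H2]]; auto.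
      { apply Hc; lia. } { rewrite Hxi_one by assumption; lra. } { apply Hdecay; lia. }
      exists (Rmin d1 d2). split. now apply Rmin_pos.
      intros d Hd. pose proof (Rmin_l d1 d2). pose proof (Rmin_r d1 d2). split; [|split].
      + intros p Hp Hpq. apply H1; auto; lra.
      + intros; lia.
      + intros _ n N t HN Ht. apply H2; auto; lra. }
  specialize (Hlocal delta ltac:(lra)).
  destruct (uniform_gap (fun t => Cmod (f t)) a (a + 2 * PI) delta xi Q)
    as [k1 [Hk1 Hgap]]; auto.
  { lra. } { intros t. now apply continuous_Cmod_comp. } { intros; apply Cmod_ge_0. }
  { intros t Ht Hne. destruct (Rle_dec t PI) as [HtPI|HtPI].
    - apply Hlt1; auto. unfold a in Ht. lra.
    - replace t with (t - 2 * PI + 2 * PI) by ring. unfold f. rewrite fourier_periodic.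
      apply Hlt1. unfold a in Ht; lra.
      intros q Hq. specialize (Hxia q Hq). lra. }
  destruct (finite_radius Q1 (fun q d => d <= b q * delta ^ m)) as [k2 [Hk2 Hkb]].
  { intros q Hq. exists (b q * delta ^ m). split; [|intros; lra].
    apply Rmult_lt_0_compat; [now apply Hb|now apply pow_lt]. }
  set (kappa := Rmin k1 k2).
  assert (Hkappa : 0 < kappa) by now apply Rmin_pos.
  specialize (Hkb kappa ltac:(split; [assumption|apply Rmin_r])).
  (* With this [gam], the truncation error of [inv_fourier_model] is at most
     [1 / (gam N ^ 2)] for each [q]. *)
  destruct (finite_radius Q1 (fun q d => 6 * d <= tau * Rpower (b q) (1 / INR m) ^ 2))
    as [gam [Hgam Htail]].
  { intros q Hq. set (u := tau * Rpower (b q) (1 / INR m) ^ 2).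
    assert (0 < u) by (apply Rmult_lt_0_compat; [lra|apply pow_lt, exp_pos]).
    exists (u / 6). split; [lra|]. intros; lra. }
  specialize (Htail gam ltac:(lra)).
  set (K := 2 + / kappa).
  assert (HK : 0 < K) by (assert (0 < / kappa) by (now apply Rinv_0_lt_compat); unfold K; lra).
  (* All errors other than the profiles add up to at most [M / N ^ 2]. *)
  set (M := (INR Q1 + 1) * K + INR Q1 * / gam).
  assert (HM : 0 < M).
  { assert (0 < / gam) by now apply Rinv_0_lt_compat.
    assert (0 < (INR Q1 + 1) * K) by (apply Rmult_lt_0_compat; lra).
    assert (0 <= INR Q1 * / gam) by (apply Rmult_le_pos; lra). unfold M; lra. }
  assert (HX : 0 < 2 * M / eps) by (apply Rdiv_lt_0_compat; lra).
  generalize (eventually_root_ge m (2 * M / eps) Hm_pos HX). apply filter_imp.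
  intros n [Hn HNX] x.
  assert (Hn0 : 0 < INR n) by (apply lt_0_INR; lia).
  rewrite Rpower_Ropp.
  pose proof (Rpower_root_pow m (INR n) Hm_pos Hn0) as HNm.
  assert (HN : 0 < Rpower (INR n) (1 / INR m)) by apply exp_pos.
  set (N := Rpower (INR n) (1 / INR m)) in *.
  set (E := fun q t => model m (f (xi q)) (alpha q) (b q) (b' q) n (t - xi q)).
  assert (CE : forall q, Ccontinuous (E q)).
  { intros q t. apply (continuous_comp (fun t => t - xi q)).
    apply (ex_derive_continuous (fun t => t - xi q)). auto_derive. exact I.
    apply continuous_model. }
  rewrite (conv_pow_inv_fourier phi a n x Hsum). fold f.
  change (Cmod (inv_fourier a (fun t => f t ^ n)%C x - Csum (fun q =>
    main_term m (f (xi q)) (xi q) (alpha q) (b q) (b' q) n x) Q1) <= eps * / N).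
  eapply Rle_trans.
  { apply (Cmod_triangle3 _ (inv_fourier a (fun t => Csum (fun q => E q t) Q1) x)). }
  destruct (is_RInt_sum_le (fun q t => profile eps1 (N * (t - xi q))) Q a (a + 2 * PI)
    (4 * PI * eps1 / N)) as [l [Il Ll]].
  { intros q _. now apply is_RInt_profile. }
  set (rest := (INR Q1 + 1) * exp (- (INR n * kappa))).
  assert (A : Cmod (inv_fourier a (fun t => f t ^ n)%C x -
      inv_fourier a (fun t => Csum (fun q => E q t) Q1) x) <= / (2 * PI) * (l + 2 * PI * rest)).
  { apply (inv_fourier_diff_le a (fun t => f t ^ n)%C (fun t => Csum (fun q => E q t) Q1)
      (fun t => sum_n_m (fun q => profile eps1 (N * (t - xi q))) 1 Q + rest)).
    - intros t. now apply continuous_Cpow.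
    - now apply continuous_Csum.
    - apply (error_majorant m f Q Q1 xi alpha b b' eps1 delta kappa a (a + 2 * PI) N n); auto.
      + intros; apply Hxi_one; lia.
      + intros p q Hp Hq Hpq. now apply Hlocal.
      + intros q t Hq Ht. apply Hlocal; auto; lia.
      + intros q t Hq Ht. apply Hlocal; auto; lia.
      + intros t Ht Hfar. apply Rle_trans with (1 := Hgap t Ht Hfar).
        apply exp_le, Ropp_le_contravar, Rmin_l.
    - apply (is_RInt_plus (V := R_NormedModule)). exact Il.
      replace (2 * PI * rest) with (scal (a + 2 * PI - a) rest)
        by (unfold scal; simpl; unfold mult; simpl; ring).
      apply (is_RInt_const (V := R_NormedModule)). }
  assert (B : Cmod (inv_fourier a (fun t => Csum (fun q => E q t) Q1) x - Csum (fun q =>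
      main_term m (f (xi q)) (xi q) (alpha q) (b q) (b' q) n x) Q1)
      <= INR Q1 * (/ gam * / N ^ 2)).
  { rewrite inv_fourier_sum by assumption. apply Cmod_sum_diff_le. intros q Hq.
    destruct (Hwin q ltac:(lia)).
    eapply Rle_trans. apply inv_fourier_model with (tau := tau); auto.
    { apply Hxi_one; lia. }
    fold N. specialize (Htail q Hq). set (be := Rpower (b q) (1 / INR m)) in *.
    assert (Hbe : 0 < be) by apply exp_pos.
    assert (HN2 : 0 < N ^ 2) by now apply pow_lt.
    assert (Hbe2 : 0 < be ^ 2) by now apply pow_lt.
    rewrite Rpow_mult_distr.
    replace (6 / (tau * (be ^ 2 * N ^ 2))) with (6 * / (tau * be ^ 2) * / N ^ 2) by (field; lra).
    apply Rmult_le_compat_r. left; now apply Rinv_0_lt_compat.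
    replace (/ gam) with (6 * / (6 * gam)) by (field; lra).
    apply Rmult_le_compat_l; [lra|]. apply Rinv_le_contravar; lra. }
  assert (R1 : rest <= (INR Q1 + 1) * (K * / N ^ 2)).
  { apply Rmult_le_compat_l; [lra|]. rewrite <- HNm, Rmult_comm.
    eapply Rle_trans; [now apply exp_even_pow_le|]. fold K.
    apply Rmult_le_compat_l; [lra|]. assert (0 < N ^ 2) by now apply pow_lt.
    apply Rinv_le_contravar; lra. }
  assert (R2 : / (2 * PI) * (l + 2 * PI * rest) <= eps / 2 * / N + rest).
  { apply Rmult_le_reg_l with (2 * PI). lra.
    replace (2 * PI * (/ (2 * PI) * (l + 2 * PI * rest))) with (l + 2 * PI * rest) by (field; lra).
    assert (X : INR Q * (4 * PI * eps1 / N) <= PI * eps * / N).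
    { replace (INR Q * (4 * PI * eps1 / N)) with ((INR Q * (4 * eps1)) * (PI * / N)) by (field; lra).
      replace (PI * eps * / N) with (eps * (PI * / N)) by ring.
      apply Rmult_le_compat_r.
      apply Rmult_le_pos; [lra|left; now apply Rinv_0_lt_compat].
      apply Rle_trans with ((INR Q + 1) * (4 * eps1)).
      apply Rmult_le_compat_r; lra. right. unfold eps1. field. lra. }
    lra. }
  assert (R3 : M * / N ^ 2 <= eps / 2 * / N).
  { apply Rmult_le_reg_r with (N ^ 2). now apply pow_lt.
    replace (M * / N ^ 2 * N ^ 2) with M by (field; lra).
    replace (eps / 2 * / N * N ^ 2) with (eps / 2 * N) by (field; lra).
    replace M with (eps / 2 * (2 * M / eps)) by (field; lra).
    apply Rmult_le_compat_l; lra. }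
  replace (M * / N ^ 2) with ((INR Q1 + 1) * (K * / N ^ 2) + INR Q1 * (/ gam * / N ^ 2)) in R3
    by (unfold M; ring).
  lra.
Qed.
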